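(* Let $N_1$ and $N_2$ be two locally identifiable spring-dashpot networks, with types $T_1,T_2\in\{A,B,C,D\}$ respectively. Then the network obtained by joining $N_1$ and $N_2$ in parallel (respectively in series) is locally identifiable of type $T_1\oplus T_2$ (respectively $T_1\odot T_2$) if that entry of the following tables is one of $A,B,C,D$, and it is unidentifiable if that entry is $u$. Both operations are commutative. Parallel connection ($\oplus$): $A\oplus A=u$, $A\oplus B=C$, $A\oplus C=u$, $A\oplus D=A$, $B\oplus B=u$, $B\oplus C=u$, $B\oplus D=B$, $C\oplus C=u$, $C\oplus D=C$, $D\oplus D=D$. Series connection ($\odot$): $A\odot A=u$, $A\odot B=D$, $A\odot C=A$, $A\odot D=u$, $B\odot B=u$, $B\odot C=B$, $B\odot D=u$, $C\odot C=C$, $C\odot D=D$, $D\odot D=u$.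
   Context: Spring-dashpot networks. A spring with constant $E$ (relation $E\epsilon=\sigma$ between strain $\epsilon$ and stress $\sigma$) and a dashpot with constant $\eta$ (relation $\eta\dot\epsilon=\sigma$) are networks (the basic elements). If $N_1,N_2$ are networks with disjoint sets of parameters, their parallel connection $N_1\lor N_2$ and series connection $N_1\land N_2$ are networks; all networks arise in this way. The operations $\lor$ and $\land$ are each regarded as commutative and associative. Constitutive equation. Each network has a constitutive equation $L\epsilon=L'\sigma$, where $L,L'$ are linear differential operators, viewed as polynomials in $x=d/dt$, whose coefficients are functions of the parameters $E_j,\eta_k$. For basic elements it is given above. If $N_1,N_2$ have constitutive equations $L_1\epsilon_1=L_2\sigma_1$ and $L_3\epsilon_2=L_4\sigma_2$, then $N_1\land N_2$ has constitutive equation $L_1L_3\epsilon=(L_1L_4+L_2L_3)\sigma$ divided by $\gcd(L_1,L_3)$ (stresses equal, strains add), and $N_1\lor N_2$ has constitutive equation $(L_1L_4+L_2L_3)\epsilon=L_2L_4\sigma$ divided by $\gcd(L_2,L_4)$ (strains equal, stresses add). Parameters are treated as independent indeterminates, so gcds are taken over the field of rational functions in the parameters, and a coefficient is nonzero if it is not identically zero. The equation is normalized by dividing through so that the leading coefficient on one chosen side ($\epsilon$ or $\sigma$) equals $1$. The non-monic coefficients are the remaining nonzero coefficients on both sides; $d$ is their number, and $\mathbf c$ is the vector of them. Types. Write the constitutive equation as $a_{n+1}\epsilon^{(n+1)}+a_n\epsilon^{(n)}+\cdots+a_0\epsilon=b_n\sigma^{(n)}+\cdots+b_0\sigma$, where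 $n$ is the order of the highest derivative of $\sigma$ that appears. The network is of type A if $b_0b_n\ne0$, $a_{n+1}=0$, $a_0a_n\neq 0$; type B if $b_0b_n\ne0$, $a_0=0$, $a_1a_{n+1}\ne0$; type C if $b_0b_n\neq0$, $a_0a_{n+1}\ne0$; type D if $b_0b_n\ne0$, $a_{n+1}=a_0=0$, $a_1a_n\neq0$. Identifiability. For a network with $N$ springs and $K$ dashpots and parameter space $\Theta=\mathbb R_{>0}^{N+K}$, regard $\mathbf c$ as a map $\mathbf c:\Theta\to\mathbb R^d$. The model is locally identifiable if $\mathbf c$ is finite-to-one and unidentifiable if $\mathbf c$ is infinite-to-one. These notions are meant generically: for almost every $\theta\in\Theta$ the fiber $\mathbf c^{-1}(\mathbf c(\theta))$ is, respectively, finite, infinite. *)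

(* Defs.v *)
From HB Require Import structures.
From mathcomp Require Import all_boot all_order all_algebra.
(* mpoly has to be imported before MathComp-Analysis: in the other order some
   of their notations clash. *)
From mathcomp Require Import mpoly.
From mathcomp Require Import all_classical all_reals all_analysis.

Set Implicit Arguments.
Unset Strict Implicit.
Unset Printing Implicit Defensive.
Import Order.TTheory GRing.Theory Num.Theory.
Import numFieldNormedType.Exports.

Local Open Scope classical_set_scope.
Local Open Scope ring_scope.

Local Notation tofrac := (@FracField.tofrac _).

(* [Par] is the connection written \/ and [Ser] the one written /\.  The leaves
   carry no names: the parameters of a network are its leaves, numbered from
   left to right, so two subnetworks joined by [Par] or [Ser] automatically
   have disjoint sets of parameters.  A network modulo commutativity and
   associativity of the connections is represented by any of its trees. *)
Inductive network := Spring | Dashpot | Par of network & network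
                   | Ser of network & network.

Fixpoint nparams (N : network) : nat :=
  match N with
  | Spring | Dashpot => 1
  | Par N1 N2 | Ser N1 N2 => nparams N1 + nparams N2
  end.

(* The pair (L, L') stands for the equation L eps = L' sigma, 'X standing for
   d/dt; [v] gives the values, in the field F, of the parameters. *)
Fixpoint constitutive (F : fieldType) (N : network) :
    ('I_(nparams N) -> F) -> {poly F} * {poly F} :=
  match N return ('I_(nparams N) -> F) -> {poly F} * {poly F} with
  | Spring => fun v => ((v ord0)%:P, 1)
  | Dashpot => fun v => (v ord0 *: 'X, 1)
  | Par N1 N2 => fun v =>
      let: (L1, L2) := constitutive (fun i => v (lshift (nparams N2) i)) in
      let: (L3, L4) := constitutive (fun i => v (rshift (nparams N1) i)) in
      let g := gcdp L2 L4 in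
      ((L1 * L4 + L2 * L3) %/ g, (L2 * L4) %/ g)
  | Ser N1 N2 => fun v =>
      let: (L1, L2) := constitutive (fun i => v (lshift (nparams N2) i)) in
      let: (L3, L4) := constitutive (fun i => v (rshift (nparams N1) i)) in
      let g := gcdp L1 L3 in
      ((L1 * L3) %/ g, (L1 * L4 + L2 * L3) %/ g)
  end.

Definition ratfun (R : realType) (n : nat) : fieldType :=
  {fraction {mpoly R[n]}}.

Definition indet (R : realType) (n : nat) (i : 'I_n) : ratfun R n :=
  tofrac ('X_i : {mpoly R[n]}).

(* The constitutive equation with the parameters taken as independent
   indeterminates. *)
Definition generic_equation (R : realType) (N : network) :
    {poly ratfun R (nparams N)} * {poly ratfun R (nparams N)} :=
  constitutive (@indet R (nparams N)).

Inductive side := StrainSide | StressSide.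

Definition normalized (F : fieldType) (s : side) (eqn : {poly F} * {poly F}) :
    {poly F} * {poly F} :=
  let: (L, L') := eqn in
  let k := match s with StrainSide => lead_coef L | StressSide => lead_coef L' end
  in (k^-1 *: L, k^-1 *: L').

(* A polynomial is the sequence of its coefficients in increasing degree, so
   [take (size L).-1 L] is L without its leading coefficient. *)
Definition nonmonic_coefs (F : fieldType) (s : side)
    (eqn : {poly F} * {poly F}) : seq F :=
  let: (L, L') := normalized s eqn in
  [seq a <- match s with
            | StrainSide => take (size L).-1 L ++ L'
            | StressSide => L ++ take (size L').-1 L'
            end | a != 0].

(* The value at [t] of the rational function [r]: p(t)/q(t) for any fraction
   p/q representing [r] with q(t) <> 0 (two such fractions give the same value);
   the default 0 is used only where [r] is not defined. *)
Definition ratfun_eval (R : realType) (n : nat) (t : n.-tuple R)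
    (r : ratfun R n) : R :=
  xget 0 [set y : R | exists p q : {mpoly R[n]},
    [/\ r = tofrac p / tofrac q,
        q.@[tnth t] != 0 &
        y = p.@[tnth t] / q.@[tnth t]]].

Definition ncoefs (R : realType) (s : side) (N : network) : nat :=
  size (nonmonic_coefs s (generic_equation R N)).

Definition coef_map (R : realType) (s : side) (N : network)
    (t : (nparams N).-tuple R) : (ncoefs R s N).-tuple R :=
  [tuple of map (ratfun_eval t)
                (in_tuple (nonmonic_coefs s (generic_equation R N)))].

Definition param_space (R : realType) (n : nat) : set (n.-tuple R) :=
  [set t | forall i, 0 < tnth t i].

Definition coef_fiber (R : realType) (s : side) (N : network)
    (t : (nparams N).-tuple R) : set ((nparams N).-tuple R) :=
  [set u | @param_space R _ u /\ coef_map s u = coef_map s t].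

(* n-dimensional Lebesgue measure (of a Borel set), by Tonelli's formula. *)
Fixpoint lebesgue_tuple (R : realType) (n : nat) : set (n.-tuple R) -> \bar R :=
  match n return set (n.-tuple R) -> \bar R with
  | 0 => fun A => \d_ [tuple] A
  | m.+1 => fun A => (\int[@lebesgue_measure R]_x
                        lebesgue_tuple [set t : m.-tuple R | A (cons_tuple x t)])%E
  end.

Definition locally_identifiable (R : realType) (s : side) (N : network) : Prop :=
  {ae @lebesgue_tuple R (nparams N), forall t,
     @param_space R _ t -> finite_set (coef_fiber s t)}.

Definition unidentifiable (R : realType) (s : side) (N : network) : Prop :=
  {ae @lebesgue_tuple R (nparams N), forall t,
     @param_space R _ t -> infinite_set (coef_fiber s t)}.

Inductive ntype := TypeA | TypeB | TypeC | TypeD.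

(* The bound on [size L] says that no derivative of the strain of order greater
   than n + 1 appears. *)
Definition has_type (R : realType) (N : network) (T : ntype) : Prop :=
  let: (L, L') := generic_equation R N in
  let n := (size L').-1 in
  let a i := L`_i in
  let b i := L'`_i in
  [/\ (size L <= n.+2)%N, b 0%N * b n != 0 &
      match T with
      | TypeA => a n.+1 = 0 /\ a 0%N * a n != 0
      | TypeB => a 0%N = 0 /\ a 1%N * a n.+1 != 0
      | TypeC => a 0%N * a n.+1 != 0
      | TypeD => [/\ a n.+1 = 0, a 0%N = 0 & a 1%N * a n != 0]
      end].

(* In both tables [None] is the entry u. *)
Definition par_table (T1 T2 : ntype) : option ntype :=
  match T1, T2 with
  | TypeA, TypeA => None
  | TypeA, TypeB | TypeB, TypeA => Some TypeC
  | TypeA, TypeC | TypeC, TypeA => None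
  | TypeA, TypeD | TypeD, TypeA => Some TypeA
  | TypeB, TypeB => None
  | TypeB, TypeC | TypeC, TypeB => None
  | TypeB, TypeD | TypeD, TypeB => Some TypeB
  | TypeC, TypeC => None
  | TypeC, TypeD | TypeD, TypeC => Some TypeC
  | TypeD, TypeD => Some TypeD
  end.

Definition ser_table (T1 T2 : ntype) : option ntype :=
  match T1, T2 with
  | TypeA, TypeA => None
  | TypeA, TypeB | TypeB, TypeA => Some TypeD
  | TypeA, TypeC | TypeC, TypeA => Some TypeA
  | TypeA, TypeD | TypeD, TypeA => None
  | TypeB, TypeB => None
  | TypeB, TypeC | TypeC, TypeB => Some TypeB
  | TypeB, TypeD | TypeD, TypeB => None
  | TypeC, TypeC => Some TypeC
  | TypeC, TypeD | TypeD, TypeC => Some TypeD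
  | TypeD, TypeD => None
  end.

Definition joined_as (R : realType) (s : side) (N : network)
    (entry : option ntype) : Prop :=
  match entry with
  | Some T => locally_identifiable R s N /\ has_type R N T
  | None => unidentifiable R s N
  end.

(* Main.v *)
From HB Require Import structures.
Require Import Defs.
From mathcomp Require Import all_boot all_order all_algebra.
From mathcomp Require Import complex zify ring lra.
From mathcomp Require Import mpoly.
From mathcomp Require Import all_classical all_reals all_analysis measurable_realfun.

(* Write the constitutive equation as x^z M eps = L' sigma with M(0), L'(0) <> 0;
   let n be the degree of L', n + e that of x^z M.  The pair (z, e) in {0,1}^2 is
   the type of the network, and for a network with m parameters
   m + z >= 2 n + 1 + e, the number of non-monic coefficients being at most
   2 n + 1 + e - z.  Par and Ser preserve equality in m + z >= 2 n + 1 + e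
   exactly at the entries of the tables that are not u.

   If equality fails there are fewer coefficients than parameters, so a nonzero
   polynomial vector field moves all coefficients proportionally.  Euler
   polygons along it, together with the compactness of a box, give for each
   small h a point of the fiber at which one given coordinate has moved by
   exactly h, so generic fibers are infinite.

   If equality holds, the fibers over all points at which M and L' are coprime
   are finite, by induction on the network.  For Par, L' = L2 L4 has finitely
   many factorizations into monic polynomials, and for each of them
   L1 L4 + L2 L3 = L determines L1 and L3, because the kernel consists of the
   pairs (N L2, - N L4), which degrees and orders at 0 exclude unless N = 0.
   Coprimality of M and L' is inherited by the two parts of every point of the
   fiber, whence the induction.  Ser is dual.

   Generic coprimality comes from rescaling time (multiplying all eta_k by a
   constant): it scales the roots of one of two networks away from those of the
   other. *)

Set Implicit Arguments.
Unset Strict Implicit.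
Unset Printing Implicit Defensive.
Import Order.TTheory GRing.Theory Num.Theory.
Import numFieldNormedType.Exports.

Local Open Scope classical_set_scope.
Local Open Scope ring_scope.

Local Notation tofrac := (@FracField.tofrac _).

(* [no_const N]: a_0 = 0.  [excess N]: a_{n+1} <> 0.  [sigma_order N]: n. *)
Fixpoint no_const (N : network) : bool :=
  match N with
  | Spring => false
  | Dashpot => true
  | Par N1 N2 => no_const N1 && no_const N2
  | Ser N1 N2 => no_const N1 || no_const N2
  end.

Fixpoint excess (N : network) : bool :=
  match N with
  | Spring => false
  | Dashpot => true
  | Par N1 N2 => excess N1 || excess N2
  | Ser N1 N2 => excess N1 && excess N2
  end.

Fixpoint sigma_order (N : network) : nat :=
  match N with
  | Spring | Dashpot => 0
  | Par N1 N2 => sigma_order N1 + sigma_order N2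
  | Ser N1 N2 => sigma_order N1 + sigma_order N2 + (excess N1 || excess N2)
                 - (no_const N1 && no_const N2)
  end.

Definition lpart (A : Type) n1 n2 (v : 'I_(n1 + n2) -> A) : 'I_n1 -> A :=
  fun i => v (lshift n2 i).
Definition rpart (A : Type) n1 n2 (v : 'I_(n1 + n2) -> A) : 'I_n2 -> A :=
  fun i => v (rshift n1 i).
Definition glue (A : Type) n1 n2 (v1 : 'I_n1 -> A) (v2 : 'I_n2 -> A) :
    'I_(n1 + n2) -> A :=
  fun i => match fintype.split i with inl j => v1 j | inr j => v2 j end.

(* L1 L4 + L2 L3 divided by x^min(z1, z2). *)
Definition cross (A : comNzRingType) (z1 z2 : bool) (p1 p2 : {poly A} * {poly A}) :=
  'X^(z1 && ~~ z2) * (p1.1 * p2.2) + 'X^(z2 && ~~ z1) * (p2.1 * p1.2).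

(* The pair (M, L') of an equation x^z M eps = L' sigma, z = [no_const N], in
   which the common factor x of L1 and L3 has been cancelled but nothing else. *)
Fixpoint core (A : comNzRingType) (N : network) :
    ('I_(nparams N) -> A) -> {poly A} * {poly A} :=
  match N return ('I_(nparams N) -> A) -> {poly A} * {poly A} with
  | Spring => fun v => ((v ord0)%:P, 1)
  | Dashpot => fun v => ((v ord0)%:P, 1)
  | Par N1 N2 => fun v =>
      let p1 := core (lpart v) in let p2 := core (rpart v) in
      (cross (no_const N1) (no_const N2) p1 p2, p1.2 * p2.2)
  | Ser N1 N2 => fun v =>
      let p1 := core (lpart v) in let p2 := core (rpart v) in
      (p1.1 * p2.1, cross (no_const N1) (no_const N2) p1 p2)
  end.

(** * Degrees and coefficients of the constitutive polynomials *)

Lemma lpart_glue (A : Type) n1 n2 (v1 : 'I_n1 -> A) (v2 : 'I_n2 -> A) :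
  lpart (glue v1 v2) = v1.
Proof.
apply/funext => i; rewrite /lpart /glue; case: splitP => j /= e.
  by congr v1; apply/val_inj.
by have := ltn_ord i; rewrite e; lia.
Qed.

Lemma rpart_glue (A : Type) n1 n2 (v1 : 'I_n1 -> A) (v2 : 'I_n2 -> A) :
  rpart (glue v1 v2) = v2.
Proof.
apply/funext => i; rewrite /rpart /glue; case: splitP => j /= e.
  by have := ltn_ord j; rewrite -e; lia.
by congr v2; apply/val_inj => /=; lia.
Qed.

Lemma glue_parts (A : Type) n1 n2 (v : 'I_(n1 + n2) -> A) :
  glue (lpart v) (rpart v) = v.
Proof.
apply/funext => i; rewrite /glue /lpart /rpart; case: splitP => j /= e;
  by congr v; apply/val_inj.
Qed.

Lemma glue_gt0 (R : numDomainType) n1 n2 (v1 : 'I_n1 -> R) (v2 : 'I_n2 -> R) :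
  (forall i, 0 < v1 i) -> (forall i, 0 < v2 i) -> forall i, 0 < glue v1 v2 i.
Proof. by move=> p1 p2 i; rewrite /glue; case: fintype.split. Qed.

Lemma cross_map (A B : comNzRingType) (f : {rmorphism A -> B}) z1 z2 p1 p2 :
  map_poly f (cross z1 z2 p1 p2) =
  cross z1 z2 (map_poly f p1.1, map_poly f p1.2) (map_poly f p2.1, map_poly f p2.2).
Proof. by rewrite /cross /= rmorphD !rmorphM /= !map_polyXn. Qed.

Lemma core_map (A B : comNzRingType) (f : {rmorphism A -> B}) N
    (v : 'I_(nparams N) -> A) :
  core (f \o v) = (map_poly f (core v).1, map_poly f (core v).2).
Proof.
elim: N v => [||N1 IH1 N2 IH2|N1 IH1 N2 IH2] v /=.
- by rewrite map_polyC rmorph1.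
- by rewrite map_polyC rmorph1.
- have -> : lpart (f \o v) = f \o lpart v by [].
  have -> : rpart (f \o v) = f \o rpart v by [].
  by rewrite IH1 IH2 cross_map rmorphM.
- have -> : lpart (f \o v) = f \o lpart v by [].
  have -> : rpart (f \o v) = f \o rpart v by [].
  by rewrite IH1 IH2 cross_map rmorphM.
Qed.

Lemma coefXnM0 (A : nzRingType) (b : bool) (p : {poly A}) :
  ('X^b * p)`_0 = p`_0 *+ ~~ b.
Proof. by rewrite coefXnM; case: b. Qed.

Lemma cross_coef0_gt0 (R : numDomainType) z1 z2 (p1 p2 : {poly R} * {poly R}) :
  0 < p1.1`_0 -> 0 < p1.2`_0 -> 0 < p2.1`_0 -> 0 < p2.2`_0 ->
  0 < (cross z1 z2 p1 p2)`_0.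
Proof.
move=> a b c d; rewrite /cross coefD !coefXnM0 !coef0M.
by case: z1; case: z2; rewrite /= ?mulr1n ?mulr0n ?addr0 ?add0r ?addr_gt0 ?mulr_gt0.
Qed.

(** Positive leading coefficients cannot cancel, which makes the degree of the sum exact even when
    both degrees agree. *)
Lemma lead_coefD_gt0 (R : numDomainType) (p q : {poly R}) :
  0 < lead_coef p -> 0 < lead_coef q ->
  0 < lead_coef (p + q) /\ size (p + q) = maxn (size p) (size q).
Proof.
move=> p0 q0; case: (ltngtP (size p) (size q)) => h.
- by rewrite lead_coefDr // addrC size_polyDl.
- by rewrite lead_coefDl // size_polyDl.
have c0 : 0 < (p + q)`_(size p).-1.
  by rewrite coefD {2}h; apply: addr_gt0.
have s : size (p + q) = size p.
  apply/eqP; rewrite eqn_leq; apply/andP; split.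
    by rewrite (leq_trans (size_polyD _ _)) // h maxnn.
  have : ((size p).-1 < size (p + q)%R)%N.
    by rewrite ltnNge; apply/negP => /leq_sizeP /(_ _ (leqnn _)) e; rewrite e ltxx in c0.
  by case: (size p).
by rewrite /lead_coef s.
Qed.

Lemma cross_lead_gt0 (R : numDomainType) z1 z2 (p1 p2 : {poly R} * {poly R}) :
  0 < lead_coef p1.1 -> 0 < lead_coef p1.2 ->
  0 < lead_coef p2.1 -> 0 < lead_coef p2.2 ->
  0 < lead_coef (cross z1 z2 p1 p2) /\
  size (cross z1 z2 p1 p2) =
    (maxn ((z1 && ~~ z2) + (size p1.1 + size p2.2))
          ((z2 && ~~ z1) + (size p2.1 + size p1.2))).-1.
Proof.
move=> a b c d.
have lX k (p q : {poly R}) : 0 < lead_coef p -> 0 < lead_coef q ->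
    0 < lead_coef ('X^k * (p * q)) /\
    size ('X^k * (p * q)) = (k + (size p + size q)).-1.
  move=> p0 q0; rewrite lead_coef_monicM ?monicXn // lead_coefM mulr_gt0 //.
  have pn0 : p != 0 by rewrite -lead_coef_eq0 gt_eqF.
  have qn0 : q != 0 by rewrite -lead_coef_eq0 gt_eqF.
  rewrite size_monicM ?monicXn ?mulf_neq0 // size_polyXn.
  rewrite size_proper_mul ?mulf_neq0 ?lead_coef_eq0 //; split=> //.
  by move: pn0; rewrite -size_poly_gt0; lia.
have [a1 s1] := lX (z1 && ~~ z2) _ _ a d.
have [a2 s2] := lX (z2 && ~~ z1) _ _ c b.
have [a3 s3] := lead_coefD_gt0 a1 a2.
by rewrite /cross; split => //; rewrite s3 s1 s2; lia.
Qed.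

(** Constant and leading coefficients stay positive through sums and products, so no cancellation
    lowers a degree and the flags of the network give exact sizes. The first size is shifted by
    [no_const N] because the factor x^z has been taken out. *)
Lemma core_pos (R : numDomainType) N (v : 'I_(nparams N) -> R) :
  (forall i, 0 < v i) ->
  [/\ 0 < (core v).1`_0, 0 < (core v).2`_0, 0 < lead_coef (core v).1,
      0 < lead_coef (core v).2 & size (core v).2 = (sigma_order N).+1 /\
      (size (core v).1 + no_const N = (sigma_order N + excess N).+1)%N].
Proof.
elim: N v => [||N1 IH1 N2 IH2|N1 IH1 N2 IH2] v v0 /=.
- by rewrite !coefC /= lead_coefC lead_coef1 size_poly1 ltr01 size_polyC gt_eqF.
- by rewrite !coefC /= lead_coefC lead_coef1 size_poly1 ltr01 size_polyC gt_eqF.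
- move: (IH1 (lpart v) (fun i => v0 _)) (IH2 (rpart v) (fun i => v0 _)).
  move: (core _) (core _) => p1 p2 [a1 b1 c1 d1 [s1 t1]] [a2 b2 c2 d2 [s2 t2]].
  have [l s] := cross_lead_gt0 (no_const N1) (no_const N2) c1 d1 c2 d2.
  rewrite cross_coef0_gt0 // l coef0M lead_coefM !mulr_gt0 //; split=> //.
  rewrite s size_proper_mul; last by rewrite mulf_neq0 ?gt_eqF.
  move: s1 s2 t1 t2; move: (size _) (size _) (size _) (size _) => k1 k2 k3 k4.
  by clear; case: (no_const N1); case: (no_const N2);
   case: (excess N1); case: (excess N2) => /=; lia.
- move: (IH1 (lpart v) (fun i => v0 _)) (IH2 (rpart v) (fun i => v0 _)).
  move: (core _) (core _) => p1 p2 [a1 b1 c1 d1 [s1 t1]] [a2 b2 c2 d2 [s2 t2]].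
  have [l s] := cross_lead_gt0 (no_const N1) (no_const N2) c1 d1 c2 d2.
  rewrite cross_coef0_gt0 // l coef0M lead_coefM !mulr_gt0 //; split=> //.
  have z1 : (0 < size p1.1)%N by rewrite size_poly_gt0 -lead_coef_eq0 gt_eqF.
  have z2 : (0 < size p2.1)%N by rewrite size_poly_gt0 -lead_coef_eq0 gt_eqF.
  rewrite s size_proper_mul; last by rewrite mulf_neq0 ?gt_eqF.
  move: s1 s2 t1 t2 z1 z2; move: (size _) (size _) (size _) (size _) => k1 k2 k3 k4.
  by clear; case: (no_const N1); case: (no_const N2);
   case: (excess N1); case: (excess N2) => /=; lia.
Qed.

(** A leaf gives equality, and a connection adds the slacks of its parts and something nonnegative
    that depends only on their flags. *)
Lemma nparams_gap N : (2 * sigma_order N + 1 + excess N <= nparams N + no_const N)%N.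
Proof.
elim: N => //= N1 IH1 N2 IH2; move: IH1 IH2;
case: (no_const N1); case: (no_const N2);
   case: (excess N1); case: (excess N2) => /=; lia.
Qed.

(** Keeps the truncated subtraction in [sigma_order (Ser N1 N2)] exact. *)
Lemma no_const_le N : (no_const N <= sigma_order N + excess N)%N.
Proof.
elim: N => //= N1 IH1 N2 IH2; move: IH1 IH2; case: (no_const N1);
  case: (no_const N2); case: (excess N1); case: (excess N2) => /=; lia.
Qed.

(** * Coprimality at suitable and at generic parameters *)

Lemma coprimep_Xn (F : fieldType) (p : {poly F}) k : p`_0 != 0 -> coprimep p 'X^k.
Proof.
by move=> p0; apply: coprimep_expr; rewrite coprimepX rootE horner_coef0.
Qed.

Lemma coprimep_addr_dvdp (F : fieldType) (r p q : {poly F}) :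
  r %| q -> coprimep r (p + q) = coprimep r p.
Proof. by case/dvdpP => s ->; rewrite addrC; apply: coprimep_addl_mul. Qed.

Lemma coprimep_addl_dvdp (F : fieldType) (r p q : {poly F}) :
  r %| q -> coprimep r (q + p) = coprimep r p.
Proof. by case/dvdpP => s ->; apply: coprimep_addl_mul. Qed.

Lemma dvdp_mul2 (F : fieldType) (a b r : {poly F}) : r %| a * (b * r).
Proof. by rewrite !dvdp_mull ?dvdpp. Qed.

(** Modulo [p1.2] only the summand with [p1.1 * p2.2] survives, and each of its factors, including
    the power of x, is coprime to [p1.2]; symmetrically modulo [p2.2]. *)
Lemma cross_coprime_dash (F : fieldType) z1 z2 (p1 p2 : {poly F} * {poly F}) :
  coprimep p1.1 p1.2 -> coprimep p2.1 p2.2 -> coprimep p1.2 p2.2 ->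
  p1.2`_0 != 0 -> p2.2`_0 != 0 -> coprimep (cross z1 z2 p1 p2) (p1.2 * p2.2).
Proof.
move=> c1 c2 c12 n1 n2; rewrite coprimep_sym coprimepMl; apply/andP; split.
  rewrite coprimep_addr_dvdp ?dvdp_mul2 //.
  rewrite !coprimepMr coprimep_Xn //= c12.
  by rewrite coprimep_sym c1.
rewrite coprimep_addl_dvdp ?dvdp_mul2 //.
  rewrite !coprimepMr coprimep_Xn //=.
by rewrite coprimep_sym c2 coprimep_sym.
Qed.

(** Dual to [cross_coprime_dash]: modulo [p1.1] only the summand with [p2.1 * p1.2] survives. *)
Lemma cross_coprime_spring (F : fieldType) z1 z2 (p1 p2 : {poly F} * {poly F}) :
  coprimep p1.1 p1.2 -> coprimep p2.1 p2.2 -> coprimep p1.1 p2.1 ->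
  p1.1`_0 != 0 -> p2.1`_0 != 0 -> coprimep (p1.1 * p2.1) (cross z1 z2 p1 p2).
Proof.
move=> c1 c2 c12 n1 n2; rewrite coprimepMl /cross (mulrC p1.1) (mulrC p2.1).
apply/andP; split.
  rewrite coprimep_addl_dvdp ?dvdp_mul2 //.
  rewrite !coprimepMr.
  by rewrite coprimep_Xn //= c12 c1.
rewrite coprimep_addr_dvdp ?dvdp_mul2 //.
  rewrite !coprimepMr.
by rewrite coprimep_Xn //= c2 coprimep_sym c12.
Qed.

(** A common complex root x of p and q(lam x) makes lam the quotient of a root of q by a root of p,
    where x is nonzero as p(0) is. Only finitely many lam are thus excluded. *)
Lemma exists_coprime_dilation (R : realType) (p q : {poly R}) :
  p`_0 != 0 -> q`_0 != 0 ->
  exists2 lam : R, 0 < lam & coprimep p (q \Po (lam *: 'X)).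
Proof.
move=> p0 q0.
pose f : {rmorphism R -> R[i]} := real_complex R.
have [rp ep] := closed_field_poly_normal (map_poly f p).
have [rq eq] := closed_field_poly_normal (map_poly f q).
have root_mem (r : {poly R}) s x : r`_0 != 0 ->
    map_poly f r = lead_coef (map_poly f r) *: \prod_(z <- s) ('X - z%:P) ->
    root (map_poly f r) x -> x \in s.
  move=> r0 ->; rewrite rootZ ?root_prod_XsubC //.
  by rewrite lead_coef_eq0 map_poly_eq0; apply: contra_neq r0 => ->; rewrite coef0.
pose L := [seq w / z | w <- rq, z <- rp].
(* One of the first [(size L).+1] positive integers must avoid [L]. *)
have [k kL] : exists k : nat, (k.+1%:R : R[i]) \notin L.
  apply: contrapT => /forallNP H.
  pose s := [seq (k.+1%:R : R[i]) | k <- iota 0 (size L).+1].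
  have us : uniq s.
    by rewrite map_inj_uniq ?iota_uniq // => i j /eqP; rewrite eqr_nat => /eqP[].
  have : {subset s <= L}.
    by move=> _ /mapP[i _ ->]; have /negP := H i; rewrite negbK.
  by move=> /(uniq_leq_size us); rewrite size_map size_iota ltnn.
exists k.+1%:R => //; rewrite -(coprimep_map f).
apply: Pdiv.ClosedField.root_coprimep => x rx.
rewrite map_comp_poly map_polyZ map_polyX horner_comp hornerZ hornerX.
apply/negP => rq0; move/negP: kL; apply.
have x0 : x != 0.
  apply: contraTneq rx => ->; rewrite rootE horner_coef0 coef_map.
  by rewrite fmorph_eq0.
apply/allpairsP; exists (f k.+1%:R * x, x) => /=; split.
- by apply: (root_mem q).
- by apply: (root_mem p).
- by rewrite mulfK // rmorph_nat.
Qed.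

Lemma comp_dilation_mulXn (F : fieldType) (lam : F) k (p : {poly F}) :
  ('X^k * p) \Po (lam *: 'X) = lam ^+ k *: ('X^k * (p \Po (lam *: 'X))).
Proof. by rewrite rmorphM /= comp_Xn_poly exprZn scalerAl. Qed.

(** The factor [lam ^+ z] belongs to M because x^z M becomes lam^z x^z M(lam x). The cross keeps
    [lam ^+ (z1 && z2)], since x^(z1 && z2) has been cancelled from it. *)
Lemma cross_dilation (F : fieldType) (lam : F) (z1 z2 : bool) (c1 c2 : F)
    (p1 p2 q1 q2 : {poly F} * {poly F}) :
  q1 = ((c1 * lam ^+ z1) *: (p1.1 \Po (lam *: 'X)), c1 *: (p1.2 \Po (lam *: 'X))) ->
  q2 = ((c2 * lam ^+ z2) *: (p2.1 \Po (lam *: 'X)), c2 *: (p2.2 \Po (lam *: 'X))) ->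
  cross z1 z2 q1 q2 =
  (c1 * c2 * lam ^+ (z1 && z2)) *: (cross z1 z2 p1 p2 \Po (lam *: 'X)).
Proof.
move=> -> ->; rewrite /cross /= raddfD /= !comp_dilation_mulXn !rmorphM /=.
rewrite scalerDr !scalerA -!scalerAl -!scalerAr !scalerA.
by case: z1; case: z2; congr (_ *: _ + _ *: _) => /=; rewrite ?expr0 ?expr1; ring.
Qed.

(* Multiplying the viscosities by [lam] replaces d/dt by lam d/dt. *)
Lemma core_dilation (R : realFieldType) N (v : 'I_(nparams N) -> R) (lam : R) :
  (forall i, 0 < v i) -> 0 < lam ->
  exists u : 'I_(nparams N) -> R, exists c : R,
  [/\ forall i, 0 < u i, 0 < c & core u =
    ((c * lam ^+ no_const N) *: ((core v).1 \Po (lam *: 'X)),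
     c *: ((core v).2 \Po (lam *: 'X)))].
Proof.
move=> + lam0; elim: N v => [||N1 IH1 N2 IH2|N1 IH1 N2 IH2] v v0.
- by exists v, 1; rewrite /= mul1r !scale1r comp_polyC rmorph1.
- exists (fun i => lam * v i), 1; split=> //= [i|]; first by rewrite mulr_gt0.
  by rewrite mul1r !scale1r comp_polyC rmorph1 /= polyCM mul_polyC.
- have [u1 [c1 [u10 c10 e1]]] := IH1 (lpart v) (fun i => v0 _).
  have [u2 [c2 [u20 c20 e2]]] := IH2 (rpart v) (fun i => v0 _).
  exists (glue u1 u2), (c1 * c2); split; first exact: glue_gt0.
    exact: mulr_gt0.
  rewrite /= lpart_glue rpart_glue (cross_dilation e1 e2); congr (_, _).
  by rewrite e1 e2 /= -scalerAl -scalerAr scalerA rmorphM.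
- have [u1 [c1 [u10 c10 e1]]] := IH1 (lpart v) (fun i => v0 _).
  have [u2 [c2 [u20 c20 e2]]] := IH2 (rpart v) (fun i => v0 _).
  exists (glue u1 u2), (c1 * c2 * lam ^+ (no_const N1 && no_const N2)).
  split; [exact: glue_gt0|by rewrite !mulr_gt0 // exprn_gt0|].
  rewrite /= lpart_glue rpart_glue (cross_dilation e1 e2); congr (_, _).
  rewrite e1 e2 /= -scalerAl -scalerAr scalerA rmorphM /=; congr (_ *: _).
  by case: (no_const N1); case: (no_const N2); rewrite /= ?expr0 ?expr1; ring.
Qed.

(** Dilating against the product of the two components of each core separates the first components
    and the second ones at once; coprimality inside the second core survives dilation. *)
Lemma exists_coprime_cores (R : realType) N1 N2
    (v1 : 'I_(nparams N1) -> R) (v2 : 'I_(nparams N2) -> R) :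
  (forall i, 0 < v1 i) -> (forall i, 0 < v2 i) ->
  coprimep (core v2).1 (core v2).2 ->
  exists u2 : 'I_(nparams N2) -> R,
  [/\ forall i, 0 < u2 i, coprimep (core u2).1 (core u2).2,
      coprimep (core v1).1 (core u2).1 & coprimep (core v1).2 (core u2).2].
Proof.
move=> v10 v20 c2.
have [a1 b1 _ _ _] := core_pos v10; have [a2 b2 _ _ _] := core_pos v20.
have p0 : ((core v1).1 * (core v1).2)`_0 != 0 by rewrite coef0M mulf_neq0 ?gt_eqF.
have q0 : ((core v2).1 * (core v2).2)`_0 != 0 by rewrite coef0M mulf_neq0 ?gt_eqF.
have [lam lam0] := exists_coprime_dilation p0 q0.
rewrite rmorphM /= !coprimepMl !coprimepMr => /andP[/andP[c11 _] /andP[_ c22]].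
have [u2 [c [u20 c0 e]]] := core_dilation v20 lam0.
have cl : c * lam ^+ no_const N2 != 0 by rewrite mulf_neq0 ?expf_neq0 ?gt_eqF.
have cn : c != 0 by rewrite gt_eqF.
exists u2; rewrite e /= !coprimepZl // !coprimepZr // ?coprimepZl //.
by split=> //; apply: coprimep_comp_poly.
Qed.

Lemma exists_coprime_core (R : realType) N :
  exists2 v : 'I_(nparams N) -> R, (forall i, 0 < v i) &
    coprimep (core v).1 (core v).2.
Proof.
elim: N => [||N1 [v1 v10 c1] N2 [v2' v20' c2']|N1 [v1 v10 c1] N2 [v2' v20' c2']].
- by exists (fun=> 1) => //=; rewrite coprimep1.
- by exists (fun=> 1) => //=; rewrite coprimep1.
- have [v2 [v20 c2 c12 c12']] := exists_coprime_cores v10 v20' c2'.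
  exists (glue v1 v2); first exact: glue_gt0.
  rewrite /= lpart_glue rpart_glue cross_coprime_dash // gt_eqF //.
    by case: (core_pos v10).
  by case: (core_pos v20).
- have [v2 [v20 c2 c12 c12']] := exists_coprime_cores v10 v20' c2'.
  exists (glue v1 v2); first exact: glue_gt0.
  rewrite /= lpart_glue rpart_glue cross_coprime_spring // gt_eqF //.
    by case: (core_pos v10).
  by case: (core_pos v20).
Qed.

(** * Sizes and coprimality under specialization of the parameters *)

Lemma cross_size_le (A : comNzRingType) z1 z2 (p1 p2 : {poly A} * {poly A}) :
  (size (cross z1 z2 p1 p2) <=
    maxn ((z1 && ~~ z2) + (size p1.1 + size p2.2).-1)
         ((z2 && ~~ z1) + (size p2.1 + size p1.2).-1))%N.
Proof.
have sX k (p q : {poly A}) : (size ('X^k * (p * q))%R <= k + (size p + size q).-1)%N.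
  apply: leq_trans (size_polyMleq _ _) _; rewrite size_polyXn addSn /=.
  by rewrite leq_add2l size_polyMleq.
apply: leq_trans (size_polyD _ _) _; rewrite geq_max !leq_max.
by rewrite !sX /= orbT.
Qed.

Lemma core_size_le (A : comNzRingType) N (v : 'I_(nparams N) -> A) :
  (size (core v).2 <= (sigma_order N).+1)%N /\
  (size (core v).1 + no_const N <= (sigma_order N + excess N).+1)%N.
Proof.
elim: N v => [||N1 IH1 N2 IH2|N1 IH1 N2 IH2] v /=.
- by rewrite size_poly1 size_polyC; case: (_ != 0).
- by rewrite size_poly1 size_polyC; case: (_ != 0).
- case: (IH1 (lpart v)) (IH2 (rpart v)) => + + [].
  move: (core (lpart v)) (core (rpart v)) => p1 p2.
  have := cross_size_le (no_const N1) (no_const N2) p1 p2.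
  have := size_polyMleq p1.2 p2.2; move: (size _) (size _) (size _).
  move: (size _) (size _) (size _) => k1 k2 k3 k4 k5 k6.
  by clear; case: (no_const N1); case: (no_const N2);
   case: (excess N1); case: (excess N2) => /=; lia.
- case: (IH1 (lpart v)) (IH2 (rpart v)) => + + [].
  move: (core (lpart v)) (core (rpart v)) => p1 p2.
  have := cross_size_le (no_const N1) (no_const N2) p1 p2.
  have := size_polyMleq p1.1 p2.1; move: (size _) (size _) (size _).
  have := no_const_le N1; have := no_const_le N2.
  move: (size _) (size _) (size _) => k1 k2 k3 k4 k5 k6.
  by clear; case: (no_const N1); case: (no_const N2);
   case: (excess N1); case: (excess N2) => /=; lia.
Qed.

(** The image under [f] has full size by [core_pos], mapping never raises a size, and [core_size_le]
    bounds the source. Hence the sizes agree and [f] kills no leading coefficient. *)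
Lemma core_rmorph_pos (A : comNzRingType) (R : numDomainType)
    (f : {rmorphism A -> R}) N (v : 'I_(nparams N) -> A) :
  (forall i, 0 < f (v i)) ->
  [/\ 0 < f (core v).1`_0, 0 < f (core v).2`_0, 0 < f (lead_coef (core v).1),
      0 < f (lead_coef (core v).2) & size (core v).2 = (sigma_order N).+1 /\
      (size (core v).1 + no_const N = (sigma_order N + excess N).+1)%N].
Proof.
move=> v0; have := @core_pos R N (f \o v) v0; rewrite core_map /=.
rewrite !coef_map /=; case=> -> -> a b [s1 s2].
have [t1 t2] := core_size_le v.
have u (p : {poly A}) : (size (map_poly f p) <= size p)%N by apply: size_poly.
have e1 : size (map_poly f (core v).1) = size (core v).1.
  by apply/eqP; rewrite eqn_leq u -(leq_add2r (no_const N)) s2 t2.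
have e2 : size (map_poly f (core v).2) = size (core v).2.
  by apply/eqP; rewrite eqn_leq u s1 t1.
move: a b; rewrite /lead_coef e1 e2 !coef_map => -> ->.
by rewrite -e1 -e2.
Qed.

(* [map_resultant] of the library only covers morphisms from polynomial rings. *)
Lemma rmorph_resultant (A B : nzRingType) (f : {rmorphism A -> B}) p q :
  f (lead_coef p) != 0 -> f (lead_coef q) != 0 ->
  f (resultant p q) = resultant (map_poly f p) (map_poly f q).
Proof.
move=> p0 q0; rewrite /resultant /Sylvester_mx !size_map_poly_id0 //.
rewrite -det_map_mx map_col_mx; congr (\det (col_mx _ _));
  by apply: map_lin1_mx => v; rewrite map_poly_rV rmorphM /= map_rVpoly.
Qed.

(** As the leading coefficients survive, the resultant of the images is the image of the
    resultant. *)
Lemma coprimep_map_resultant (A : idomainType) (F : fieldType)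
    (h : {rmorphism A -> F}) (p q : {poly A}) :
  h (lead_coef p) != 0 -> h (lead_coef q) != 0 ->
  coprimep (map_poly h p) (map_poly h q) = (h (resultant p q) != 0).
Proof.
move=> hp hq; have -> : h (resultant p q) = _ := rmorph_resultant hp hq.
rewrite resultant_eq0 coprimep_def.
have : gcdp (map_poly h p) (map_poly h q) != 0.
  rewrite gcdp_eq0 negb_and; apply/orP; left; apply: contra_neq hp => h0.
  have := coef_map h p (size p).-1; rewrite h0 coef0 => h1.
  by rewrite /lead_coef -h1.
by rewrite -size_poly_gt0; case: (size _) => [|[|k']].
Qed.

(** Coprimality at a single specialization [f] forces a nonzero resultant, which the injection [g]
    keeps nonzero. This lifts coprimality from a real point to the field of rational functions. *)
Lemma coprimep_specialize (A : idomainType) (F K : fieldType)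
    (f : {rmorphism A -> F}) (g : {rmorphism A -> K}) (p q : {poly A}) :
  injective g -> f (lead_coef p) != 0 -> f (lead_coef q) != 0 ->
  coprimep (map_poly f p) (map_poly f q) ->
  coprimep (map_poly g p) (map_poly g q).
Proof.
move=> gI p0 q0.
have nz (r : {poly A}) : f (lead_coef r) != 0 -> g (lead_coef r) != 0.
  rewrite -(rmorph0 g) (inj_eq gI); apply: contraNneq => ->.
  by rewrite rmorph0.
rewrite !coprimep_map_resultant ?nz //; apply: contraNneq => /eqP.
by rewrite -(rmorph0 g) (inj_eq gI) => /eqP ->; rewrite rmorph0.
Qed.

(* Stands for genericity of the parameters [w] of a subnetwork: every point of
   its parameter space is a specialization of [w]. *)
Definition covering (R : realType) m n (w : 'I_m -> {mpoly R[n]}) :=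
  forall t : 'I_m -> R, (forall i, 0 < t i) ->
  exists x : 'I_n -> R, forall i, (w i).@[x] = t i.

Lemma covering_lpart (R : realType) m1 m2 n (w : 'I_(m1 + m2) -> {mpoly R[n]}) :
  covering w -> covering (lpart w).
Proof.
move=> cw t t0; have [i|x xE] := cw (glue t (fun=> 1)); first exact: glue_gt0.
by exists x => i; rewrite xE -[LHS]/(lpart (glue t (fun=> 1)) i) lpart_glue.
Qed.

Lemma covering_rpart (R : realType) m1 m2 n (w : 'I_(m1 + m2) -> {mpoly R[n]}) :
  covering w -> covering (rpart w).
Proof.
move=> cw t t0; have [i|x xE] := cw (glue (fun=> 1) t); first exact: glue_gt0.
by exists x => i; rewrite xE -[LHS]/(rpart (glue (fun=> 1) t) i) rpart_glue.
Qed.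

Lemma tofrac_inj (A : idomainType) : injective (@FracField.tofrac A).
Proof. by move=> p q /eqP; rewrite tofrac_eq => /eqP. Qed.

Lemma core_coef0_neq0 (R : realType) N n (w : 'I_(nparams N) -> {mpoly R[n]}) :
  covering w -> (core (tofrac \o w)).1`_0 != 0 /\ (core (tofrac \o w)).2`_0 != 0.
Proof.
move=> /(_ (fun=> 1))[] // x xE.
have [i|a b _ _ _] := @core_rmorph_pos _ _ (meval x) N w; first by rewrite /= xE.
rewrite core_map /= !coef_map !tofrac_eq0.
by split; [move: a|move: b]; apply: contraTneq => ->; rewrite rmorph0 ltxx.
Qed.

(** By [covering], the coprime real cores obtained by dilation are specializations of the cores over
    rational functions, so coprimality lifts by [coprimep_specialize]. *)
Lemma core_parts_coprime (R : realType) N1 N2 n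
    (w : 'I_(nparams N1 + nparams N2) -> {mpoly R[n]}) :
  covering w ->
  coprimep (core (lpart (tofrac \o w))).1 (core (rpart (tofrac \o w))).1 /\
  coprimep (core (lpart (tofrac \o w))).2 (core (rpart (tofrac \o w))).2.
Proof.
move=> cw.
have [v1 v10 _] := exists_coprime_core R N1.
have [v2' v20' c2'] := exists_coprime_core R N2.
have [v2 [v20 _ c11 c22]] := exists_coprime_cores v10 v20' c2'.
have [|x xE] := cw (glue v1 v2); first exact: glue_gt0.
have e1 : meval x \o lpart w = v1.
  by apply/funext => i /=; rewrite /lpart xE -[LHS]/(lpart (glue v1 v2) i) lpart_glue.
have e2 : meval x \o rpart w = v2.
  by apply/funext => i /=; rewrite /rpart xE -[LHS]/(rpart (glue v1 v2) i) rpart_glue.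
have [|_ _ a1 b1 _] := @core_rmorph_pos _ _ (meval x) N1 (lpart w).
  by move=> i; have := v10 i; rewrite -e1.
have [|_ _ a2 b2 _] := @core_rmorph_pos _ _ (meval x) N2 (rpart w).
  by move=> i; have := v20 i; rewrite -e2.
move: c11 c22; rewrite -e1 -e2 !core_map /= => c11 c22.
by split; apply: (coprimep_specialize (@tofrac_inj {mpoly R[n]}) _ _ (f := meval x));
  rewrite ?gt_eqF.
Qed.

Lemma gcdp_mulXn (F : fieldType) (z1 z2 : bool) (p q : {poly F}) :
  p`_0 != 0 -> q`_0 != 0 -> coprimep p q ->
  gcdp ('X^z1 * p) ('X^z2 * q) %= 'X^(z1 && z2).
Proof.
move=> p0 q0 cpq.
case: z1; case: z2; rewrite /= ?expr0 ?mul1r ?expr1.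
- rewrite -(eqp_ltrans (mulp_gcdr _ _ _)) -{2}['X]mulr1 eqp_mull //.
  by rewrite gcdp_eqp1.
- by rewrite gcdp_eqp1 coprimepMl cpq andbT coprimep_sym -['X]expr1 coprimep_Xn.
- by rewrite gcdp_eqp1 coprimepMr cpq -['X]expr1 coprimep_Xn.
- by rewrite gcdp_eqp1.
Qed.

Lemma eqp_exists_scale (F : fieldType) (p q : {poly F}) :
  p %= q -> exists2 c, c != 0 & p = c *: q.
Proof.
case/eqpP => [[c1 c2]] /= /andP[c10 c20] e; exists (c1^-1 * c2).
  by rewrite mulf_neq0 ?invr_eq0.
by rewrite -scalerA -e scalerA mulVf ?scale1r.
Qed.

Lemma mulXn_cross (F : fieldType) (z1 z2 : bool) (p1 p2 : {poly F} * {poly F}) :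
  'X^(z1 && z2) * cross z1 z2 p1 p2 =
  'X^z1 * p1.1 * p2.2 + p1.2 * ('X^z2 * p2.1).
Proof.
by rewrite /cross; case: z1; case: z2; rewrite /= ?expr0 ?expr1; ring.
Qed.

Lemma par_core (F : fieldType) (z1 z2 : bool) (k1 k2 : F) (p1 p2 : {poly F} * {poly F}) :
  k1 != 0 -> k2 != 0 -> coprimep p1.2 p2.2 ->
  exists2 k, k != 0 &
    ((k1 *: ('X^z1 * p1.1) * (k2 *: p2.2) + k1 *: p1.2 * (k2 *: ('X^z2 * p2.1)))
       %/ gcdp (k1 *: p1.2) (k2 *: p2.2),
     (k1 *: p1.2 * (k2 *: p2.2)) %/ gcdp (k1 *: p1.2) (k2 *: p2.2)) =
    (k *: ('X^(z1 && z2) * cross z1 z2 p1 p2), k *: (p1.2 * p2.2)).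
Proof.
move=> k10 k20 cc.
have : gcdp (k1 *: p1.2) (k2 *: p2.2) %= 1.
  by rewrite gcdp_eqp1 coprimepZl // coprimepZr.
case/eqp_exists_scale => c c0 ->; rewrite !divpZr // !divp1.
exists (c^-1 * (k1 * k2)); first by rewrite !mulf_neq0 ?invr_eq0.
rewrite mulXn_cross -!scalerAl -!scalerAr !scalerA -!scalerDr !scalerA.
by rewrite -!mulrA.
Qed.

(** The flags are the only source of a common factor: the gcd is x^(z1 && z2) up to a unit, the
    power already removed from [cross]. *)
Lemma ser_core (F : fieldType) (z1 z2 : bool) (k1 k2 : F) (p1 p2 : {poly F} * {poly F}) :
  k1 != 0 -> k2 != 0 -> p1.1`_0 != 0 -> p2.1`_0 != 0 -> coprimep p1.1 p2.1 ->
  let g := gcdp (k1 *: ('X^z1 * p1.1)) (k2 *: ('X^z2 * p2.1)) in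
  exists2 k, k != 0 &
    ((k1 *: ('X^z1 * p1.1) * (k2 *: ('X^z2 * p2.1))) %/ g,
     (k1 *: ('X^z1 * p1.1) * (k2 *: p2.2) + k1 *: p1.2 * (k2 *: ('X^z2 * p2.1))) %/ g) =
    (k *: ('X^(z1 || z2) * (p1.1 * p2.1)), k *: cross z1 z2 p1 p2).
Proof.
move=> k10 k20 p10 p20 cc /=.
have : gcdp (k1 *: ('X^z1 * p1.1)) (k2 *: ('X^z2 * p2.1)) %= 'X^(z1 && z2).
  apply: eqp_trans (gcdp_mulXn z1 z2 p10 p20 cc).
  by apply: eqp_gcd; apply: eqp_scale.
case/eqp_exists_scale => c c0 ->; rewrite !divpZr //.
exists (c^-1 * (k1 * k2)); first by rewrite !mulf_neq0 ?invr_eq0.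
have -> : k1 *: ('X^z1 * p1.1) * (k2 *: ('X^z2 * p2.1)) =
    (k1 * k2) *: ('X^(z1 || z2) * (p1.1 * p2.1) * 'X^(z1 && z2)).
  rewrite -!scalerAl -!scalerAr !scalerA; congr (_ *: _).
  by case: z1 z2 => [] []; rewrite /= ?expr0 ?expr1; ring.
have -> : k1 *: ('X^z1 * p1.1) * (k2 *: p2.2) +
    k1 *: p1.2 * (k2 *: ('X^z2 * p2.1)) =
    (k1 * k2) *: (cross z1 z2 p1 p2 * 'X^(z1 && z2)).
  rewrite [cross _ _ _ _ * _]mulrC mulXn_cross.
  by rewrite -!scalerAl -!scalerAr !scalerA -!scalerDr.
by rewrite !divpZl !mulpK ?monic_neq0 ?monicXn // !scalerA.
Qed.

(** Links the definition by gcds with the division-free [core]: generically nothing but x is ever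
    cancelled. Any covering [w] is allowed because the induction restricts the variables to the
    parts of the network. *)
Lemma constitutive_core (R : realType) N n (w : 'I_(nparams N) -> {mpoly R[n]}) :
  covering w -> exists2 k, k != 0 &
    constitutive (tofrac \o w) =
    (k *: ('X^(no_const N) * (core (tofrac \o w)).1), k *: (core (tofrac \o w)).2).
Proof.
elim: N w => [||N1 IH1 N2 IH2|N1 IH1 N2 IH2] w cw.
- by exists 1; rewrite ?oner_neq0 //= !scale1r expr0 mul1r.
- exists 1; rewrite ?oner_neq0 //= !scale1r expr1 mulrC.
  by rewrite mul_polyC.
- have [k1 k10 e1] := IH1 _ (covering_lpart cw).
  have [k2 k20 e2] := IH2 _ (covering_rpart cw).
  have [_ cc] := core_parts_coprime cw.
  have [k k0 e] := par_core (no_const N1) (no_const N2) k10 k20 cc.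
  exists k => //; move: e1 e2 e => /=.
  rewrite /lpart /rpart /comp.
  by move=> -> ->.
- have [k1 k10 e1] := IH1 _ (covering_lpart cw).
  have [k2 k20 e2] := IH2 _ (covering_rpart cw).
  have [cc _] := core_parts_coprime cw.
  have [p10 _] := core_coef0_neq0 (covering_lpart cw).
  have [p20 _] := core_coef0_neq0 (covering_rpart cw).
  have [k k0 e] := ser_core (no_const N1) (no_const N2) k10 k20 p10 p20 cc.
  exists k => //; move: e1 e2 e => /=.
  rewrite /lpart /rpart /comp.
  by move=> -> ->.
Qed.

(** * Types and coefficient maps *)

Definition equation (A : comNzRingType) N (v : 'I_(nparams N) -> A) :=
  ('X^(no_const N) * (core v).1, (core v).2).

Definition variables (R : realType) n (i : 'I_n) : {mpoly R[n]} := 'X_i.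

Lemma variables_covering (R : realType) n : covering (@variables R n).
Proof. by move=> t _; exists t => i; rewrite mevalXU. Qed.

Lemma meval_variables (R : realType) n (t : 'I_n -> R) :
  meval t \o @variables R n = t.
Proof. by apply/funext => i /=; rewrite mevalXU. Qed.

Lemma equation_map (A B : comNzRingType) (f : {rmorphism A -> B}) N
    (v : 'I_(nparams N) -> A) :
  equation (f \o v) = (map_poly f (equation v).1, map_poly f (equation v).2).
Proof. by rewrite /equation core_map rmorphM /= map_polyXn. Qed.

Lemma generic_equationE (R : realType) N :
  exists2 k, k != 0 & generic_equation R N =
    (k *: map_poly tofrac (equation (@variables R (nparams N))).1,
     k *: map_poly tofrac (equation (@variables R (nparams N))).2).
Proof.
have [k k0 e] := constitutive_core (@variables_covering R (nparams N)).
exists k => //; rewrite /generic_equation -[@indet R _]/(tofrac \o @variables R _) e.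
by have := equation_map tofrac (@variables R (nparams N)); case=> <- <-.
Qed.

Lemma size_equation_map (A : comNzRingType) (R : numDomainType)
    (f : {rmorphism A -> R}) N (v : 'I_(nparams N) -> A) :
  (forall i, 0 < f (v i)) ->
  [/\ size (equation v).2 = (sigma_order N).+1,
      size (equation v).1 = (sigma_order N + excess N).+1,
      0 < f (lead_coef (equation v).1) & 0 < f (lead_coef (equation v).2)].
Proof.
move=> v0; have [_ _ a b [s2 t1]] := core_rmorph_pos v0.
have M0 : (core v).1 != 0.
  by rewrite -lead_coef_eq0; apply: contraTneq a => ->; rewrite rmorph0 ltxx.
rewrite /equation lead_coef_monicM ?monicXn //; split=> //.
by rewrite -[(_, _).1]/('X^(no_const N) * (core v).1) size_monicM ?monicXn //
  size_polyXn addSn addnC -t1.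
Qed.

Lemma size_equation (R : realType) N :
  size (equation (@variables R (nparams N))).2 = (sigma_order N).+1 /\
  size (equation (@variables R (nparams N))).1 = (sigma_order N + excess N).+1.
Proof.
have [i|a b _ _] := @size_equation_map _ _ (meval (fun=> 1)) N (@variables R _).
  by rewrite /= mevalXU ltr01.
exact: conj a b.
Qed.

Lemma equation_lead_gt0 (R : realType) N (t : 'I_(nparams N) -> R) :
  (forall i, 0 < t i) ->
  0 < (lead_coef (equation (@variables R (nparams N))).1).@[t] /\
  0 < (lead_coef (equation (@variables R (nparams N))).2).@[t].
Proof.
move=> t0.
have [i|_ _ a b] := @size_equation_map _ _ (meval t) N (@variables R _).
  by rewrite /= mevalXU.
exact: conj a b.
Qed.

(** The body of [has_type] for an arbitrary pair, so that the generic equation can be replaced by a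
    multiple of [equation]. *)
Definition equation_type (F : fieldType) (e : {poly F} * {poly F}) (T : ntype) :=
  let: (L, L') := e in
  let n := (size L').-1 in
  let a i := L`_i in
  let b i := L'`_i in
  [/\ (size L <= n.+2)%N, b 0%N * b n != 0 &
      match T with
      | TypeA => a n.+1 = 0 /\ a 0%N * a n != 0
      | TypeB => a 0%N = 0 /\ a 1%N * a n.+1 != 0
      | TypeC => a 0%N * a n.+1 != 0
      | TypeD => [/\ a n.+1 = 0, a 0%N = 0 & a 1%N * a n != 0]
      end].

Definition type_of (N : network) : ntype :=
  match no_const N, excess N with
  | false, false => TypeA
  | true, true => TypeB
  | false, true => TypeC
  | true, false => TypeD
  end.

(** a_0 vanishes exactly when z = 1, and a_(n+1) exactly when e = 0. For z = 1 the coefficient a_1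
    is M(0), for e = 0 the coefficient a_n is the leading one, so the two flags decide the type. *)
Lemma equation_typeP (F : fieldType) (L M L' : {poly F}) (z e : bool) n T :
  L = 'X^z * M -> size L = (n + e).+1 -> size L' = n.+1 ->
  M`_0 != 0 -> L'`_0 != 0 ->
  equation_type (L, L') T <->
  T = match z, e with
      | false, false => TypeA | true, true => TypeB
      | false, true => TypeC | true, false => TypeD
      end.
Proof.
move=> LE sL sL' M0 L'0; rewrite /equation_type sL' sL /=.
have L'n : L'`_n != 0 by have := lead_coef_eq0 L'; rewrite /lead_coef sL' /= => ->;
  rewrite -size_poly_eq0 sL'.
have Lne : L`_(n + e) != 0 by have := lead_coef_eq0 L; rewrite /lead_coef sL /= => ->;
  rewrite -size_poly_eq0 sL.
have L0 : (L`_0 == 0) = z.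
  by rewrite LE coefXnM; case: (z) => /=; rewrite ?eqxx // (negPf M0).
have Ln1 : (L`_n.+1 == 0) = ~~ e.
  case: (e) sL Lne => sL; rewrite ?addn1 ?addn0 => Lne; first by rewrite (negPf Lne).
  by rewrite nth_default ?eqxx // sL addn0.
have L1 : z -> L`_1 != 0 by move=> zT; rewrite LE zT coefXnM.
have Ln : e = false -> L`_n != 0 by move: Lne => /[swap] ->; rewrite addn0.
have eb : (n + e < n.+2)%N by case: (e); rewrite ?addn1 ?addn0.
split.
  case=> _ _; case: T => [[/eqP]|[/eqP]||[/eqP + /eqP]].
  - rewrite Ln1 mulf_eq0 negb_or L0 => /negPf -> /andP[/negPf -> _] //.
  - rewrite L0 mulf_eq0 negb_or Ln1 => -> /andP[_ /negPn ->] //.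
  - rewrite mulf_eq0 negb_or L0 Ln1 => /andP[/negPf -> /negPn ->] //.
  - by rewrite Ln1 L0 => /negPf -> ->.
move=> ->; split=> //; first exact: mulf_neq0.
case: (z) (e) L0 Ln1 L1 Ln => [] [] /= L0 Ln1 L1 Ln.
- by split; [exact/eqP|rewrite mulf_neq0 ?L1 ?Ln1].
- by split; [exact/eqP|exact/eqP|rewrite mulf_neq0 ?L1 ?Ln].
- by rewrite mulf_neq0 ?L0 ?Ln1.
- by split; [exact/eqP|rewrite mulf_neq0 ?L0 ?Ln].
Qed.

Lemma equation_type_map (A : idomainType) (F : fieldType) (g : {rmorphism A -> F})
    (k : F) N (v : 'I_(nparams N) -> A) T :
  injective g -> k != 0 ->
  size (equation v).2 = (sigma_order N).+1 ->
  size (equation v).1 = (sigma_order N + excess N).+1 ->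
  (core v).1`_0 != 0 -> (core v).2`_0 != 0 ->
  equation_type (k *: map_poly g (equation v).1, k *: map_poly g (equation v).2) T
  <-> T = type_of N.
Proof.
move=> gI k0 s2 s1 c1 c2.
have nz a : a != 0 -> g a != 0 by rewrite -(rmorph0 g) (inj_eq gI).
apply: (equation_typeP (M := k *: map_poly g (core v).1) (n := sigma_order N)).
- by rewrite -scalerAr rmorphM /= map_polyXn.
- by rewrite size_scale // size_map_inj_poly ?rmorph0.
- by rewrite size_scale // size_map_inj_poly ?rmorph0.
- by rewrite coefZ coef_map mulf_neq0 ?nz.
- by rewrite coefZ coef_map mulf_neq0 ?nz.
Qed.

Lemma has_typeP (R : realType) N T : has_type R N T <-> T = type_of N.
Proof.
have [k k0 e] := generic_equationE R N.
have [s2 s1] := size_equation R N.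
have [i|a b _ _ _] := @core_rmorph_pos _ _ (meval (fun=> 1)) N (@variables R _).
  by rewrite /= mevalXU ltr01.
have hE : has_type R N T <-> equation_type (generic_equation R N) T by [].
apply: iff_trans hE _; rewrite e; apply: equation_type_map k0 s2 s1 _ _.
- exact: tofrac_inj.
- by apply: contraTneq a => ->; rewrite rmorph0 ltxx.
- by apply: contraTneq b => ->; rewrite rmorph0 ltxx.
Qed.

Definition side_lead (A : nzRingType) (s : side) (e : {poly A} * {poly A}) :=
  match s with StrainSide => lead_coef e.1 | StressSide => lead_coef e.2 end.

Lemma nonmonic_coefs_scale (F : fieldType) s (k : F) (L L' : {poly F}) :
  k != 0 -> nonmonic_coefs s (k *: L, k *: L') = nonmonic_coefs s (L, L').
Proof.
move=> k0; rewrite /nonmonic_coefs /=; have e (c : F) (p : {poly F}) :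
    (k * c)^-1 *: (k *: p) = c^-1 *: p.
  by rewrite scalerA invfM mulrAC mulVf ?mul1r.
by case: s; rewrite lead_coefZ !e.
Qed.

(** [phi] and [psi] stand for the evaluations at two points. Agreement at 0 and 1 makes the
    discarded zero coefficients and the omitted monic one harmless, so all normalized coefficients
    can be compared by index. *)
Lemma nonmonic_coefsP (F : fieldType) (B : Type) s (e : {poly F} * {poly F})
    (phi psi : F -> B) :
  side_lead s e != 0 -> phi 0 = psi 0 -> phi 1 = psi 1 ->
  (forall x, x \in nonmonic_coefs s e -> phi x = psi x) <->
  (forall i, phi ((side_lead s e)^-1 * e.1`_i) = psi ((side_lead s e)^-1 * e.1`_i) /\
             phi ((side_lead s e)^-1 * e.2`_i) = psi ((side_lead s e)^-1 * e.2`_i)).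
Proof.
case: e => L L'; set c := side_lead s _ => c0 h0 h1.
have cV : c^-1 != 0 by rewrite invr_eq0.
pose l := match s with
  | StrainSide => take (size L).-1 (c^-1 *: L) ++ c^-1 *: L'
  | StressSide => c^-1 *: L ++ take (size L').-1 (c^-1 *: L') end.
have -> : nonmonic_coefs s (L, L') = [seq a <- l | a != 0].
  by move: cV; rewrite /nonmonic_coefs /l /c; case: (s) => /= cV; rewrite size_scale.
have fl : (forall x, x \in [seq a <- l | a != 0] -> phi x = psi x) <->
    (forall x, x \in l -> phi x = psi x).
  split=> h x.
    by case: (eqVneq x 0) => [-> //|x0 xl]; apply: h; rewrite mem_filter x0.
  by rewrite mem_filter => /andP[_]; apply: h.
apply: iff_trans fl _.
have full (p : {poly F}) : (forall x, x \in polyseq (c^-1 *: p) -> phi x = psi x) <->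
    (forall i, phi (c^-1 * p`_i) = psi (c^-1 * p`_i)).
  split=> [h i|h x /(nthP 0)[i _ <-]]; last by rewrite coefZ h.
  rewrite -coefZ; case: (ltnP i (size (c^-1 *: p))) => hi; first exact/h/mem_nth.
  by rewrite nth_default.
have part (p : {poly F}) : lead_coef p = c ->
    (forall x, x \in take (size p).-1 (c^-1 *: p) -> phi x = psi x) <->
    (forall i, phi (c^-1 * p`_i) = psi (c^-1 * p`_i)).
  move=> lp; apply: iff_trans (full p); split=> h x; last by move/mem_take; apply: h.
  move=> /(nthP 0)[i hi <-]; case: (ltngtP i (size p).-1) => hip.
  - apply: h; rewrite -(nth_take _ hip); apply: mem_nth.
    by rewrite size_takel // size_scale // leq_pred.
  - move: hi hip; rewrite size_scale //; case: (size p) => //= k.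
    by rewrite ltnS ltnNge => ->.
  - by rewrite hip coefZ -[p`_ _]/(lead_coef p) lp mulVf.
have catP (l1 l2 : seq F) P Q : ((forall x, x \in l1 -> phi x = psi x) <-> P) ->
    ((forall x, x \in l2 -> phi x = psi x) <-> Q) ->
    ((forall x, x \in l1 ++ l2 -> phi x = psi x) <-> P /\ Q).
  move=> [p1 p2] [q1 q2]; split=> [h|[/p2 hp /q2 hq] x].
    by split; [apply: p1|apply: q1] => x xl; apply: h; rewrite mem_cat xl ?orbT.
  by rewrite mem_cat => /orP[/hp|/hq].
rewrite /l; case sE : s.
  have lL : lead_coef L = c by rewrite /c sE.
  apply: iff_trans (catP _ _ _ _ (part L lL) (full L')) _.
  by split=> [[h h'] i|h]; split=> // i; have [] := h i.
have lL' : lead_coef L' = c by rewrite /c sE.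
apply: iff_trans (catP _ _ _ _ (full L) (part L' lL')) _.
by split=> [[h h'] i|h]; split=> // i; have [] := h i.
Qed.

Lemma ratfun_evalE (R : realType) n (t : n.-tuple R) (p q : {mpoly R[n]}) :
  q.@[tnth t] != 0 ->
  ratfun_eval t (tofrac p / tofrac q) = p.@[tnth t] / q.@[tnth t].
Proof.
move=> q0; rewrite /ratfun_eval; apply: xget_unique; first by exists p, q.
move=> _ [p' [q' [e q'0 ->]]].
have nz (r : {mpoly R[n]}) : r.@[tnth t] != 0 -> tofrac r != 0.
  by rewrite tofrac_eq0; apply: contra_neq => ->; rewrite rmorph0.
move/eqP: e; rewrite eqr_div ?nz // -!tofracM tofrac_eq => /eqP e.
by apply/eqP; rewrite eqr_div // -!mevalM e.
Qed.

(** Normalized coefficients agree exactly when the unnormalized pairs are proportional, so the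
    fibers do not depend on the side of normalization. *)
Lemma coef_map_eqP (R : realType) s N (u t : (nparams N).-tuple R) :
  param_space u -> param_space t ->
  Defs.coef_map s u = Defs.coef_map s t <->
  exists2 k, k != 0 & core (tnth u) = (k *: (core (tnth t)).1, k *: (core (tnth t)).2).
Proof.
move=> u0 t0; set E := equation (@variables R (nparams N)).
pose G := (map_poly tofrac E.1, map_poly tofrac E.2).
have cpos x : @param_space R (nparams N) x -> 0 < (side_lead s E).@[tnth x].
  by move=> x0; have [a b] := equation_lead_gt0 x0; rewrite /side_lead; case: (s).
have c0 : side_lead s E != 0.
  by apply: contraTneq (cpos _ u0) => ->; rewrite rmorph0 ltxx.
have lG : side_lead s G = tofrac (side_lead s E).
  rewrite /side_lead /G; case: (s) => /=; rewrite lead_coef_map_inj //;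
    by [exact: tofrac_inj|rewrite rmorph0].
have genE : nonmonic_coefs s (generic_equation R N) = nonmonic_coefs s G.
  have [k k0 ->] := generic_equationE R N; exact: nonmonic_coefs_scale.
have ev x : param_space x -> forall a,
    ratfun_eval x ((tofrac (side_lead s E))^-1 * tofrac a) =
    a.@[tnth x] / (side_lead s E).@[tnth x].
  by move=> x0 a; rewrite mulrC ratfun_evalE // gt_eqF // cpos.
have ev0 x : ratfun_eval x (0 : ratfun R (nparams N)) = 0.
  have := @ratfun_evalE R _ x 0 1; rewrite !rmorph0 !rmorph1 oner_neq0 mul0r.
  by move=> ->; rewrite ?mul0r.
have ev1 x : ratfun_eval x (1 : ratfun R (nparams N)) = 1.
  have := @ratfun_evalE R _ x 1 1; rewrite !rmorph1 oner_neq0 divr1.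
  by move=> ->; rewrite ?divr1.
have mapE : Defs.coef_map s u = Defs.coef_map s t <->
    forall x, x \in nonmonic_coefs s G -> ratfun_eval u x = ratfun_eval t x.
  rewrite -genE; split=> [/(congr1 val) /= /eq_in_map //|h].
  by apply: val_inj => /=; apply/eq_in_map.
apply: iff_trans mapE _.
apply: iff_trans (nonmonic_coefsP _ _ _) _; rewrite ?ev0 ?ev1 //.
  by rewrite lG tofrac_eq0.
rewrite lG.
have eqE x : equation (tnth x) =
    (map_poly (meval (tnth x)) E.1, map_poly (meval (tnth x)) E.2).
  by rewrite -equation_map meval_variables.
split=> [h|[k k0 e] i].
  (* The factor is the ratio of the leading coefficients on the side [s]. *)
  exists ((side_lead s E).@[tnth u] / (side_lead s E).@[tnth t]).
    by rewrite mulf_neq0 ?invr_eq0 ?gt_eqF ?cpos.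
  set k := _ / _.
  have [e1 e2] : (equation (tnth u)).1 = k *: (equation (tnth t)).1 /\
      (equation (tnth u)).2 = k *: (equation (tnth t)).2.
    rewrite !eqE; split; apply/polyP => i /=; rewrite coefZ !coef_map /=.
      have [+ _] := h i; rewrite /G /= !coef_map !ev //.
      move/(canRL (divfK _)) => -> ; rewrite ?gt_eqF ?cpos //.
      by rewrite /k mulrC mulrA mulrAC.
    have [_ +] := h i; rewrite /G /= !coef_map !ev //.
    move/(canRL (divfK _)) => -> ; rewrite ?gt_eqF ?cpos //.
    by rewrite /k mulrC mulrA mulrAC.
  move: e1 e2; rewrite /equation /= scalerAr => e1 e2.
  rewrite [LHS]surjective_pairing; congr (_, _) => //.
  exact: (mulfI (monic_neq0 (monicXn _ _)) e1).
have eE : equation (tnth u) = (k *: (equation (tnth t)).1, k *: (equation (tnth t)).2).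
  by rewrite /equation e /= scalerAr.
have co : forall i, (E.1`_i).@[tnth u] = k * (E.1`_i).@[tnth t] /\
    (E.2`_i).@[tnth u] = k * (E.2`_i).@[tnth t].
  move=> j; move: eE; rewrite !eqE => -[/polyP/(_ j) + /polyP/(_ j)].
  by rewrite !coefZ !coef_map /=.
have cE : (side_lead s E).@[tnth u] = k * (side_lead s E).@[tnth t].
  have [h1 _] := co (size E.1).-1; have [_ h2] := co (size E.2).-1.
  by rewrite /side_lead /lead_coef; case: (s).
rewrite /G /= !coef_map !ev // cE; have [-> ->] := co i.
by rewrite !invfM !mulrA ![k * _ / k]mulrAC mulfV // !mul1r.
Qed.

(** * Finiteness of the fibers of tight networks *)

(** Over the complex numbers a monic divisor is the product over a subfamily of the roots of [Q],
    and there are finitely many subfamilies. *)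
Lemma finite_monic_divisors (R : realType) (Q : {poly R}) :
  Q != 0 -> finite_set [set d : {poly R} | d \is monic /\ d %| Q].
Proof.
move=> Q0; pose f : {rmorphism R -> R[i]} := real_complex R.
have [r rE] := closed_field_poly_normal (map_poly f Q).
pose S := [seq \prod_(z <- mask m r) ('X - z%:P) | m : (size r).-tuple bool].
have fS : finite_set ((map_poly f) @^-1` [set` S]).
  apply: finite_preimage; last exact: finite_seq.
  by move=> p q _ _; apply: map_poly_inj.
apply: sub_finite_set fS => d /= [dm dQ].
have : map_poly f d %| \prod_(z <- r) ('X - z%:P).
  have c0 : lead_coef (map_poly f Q) != 0 by rewrite lead_coef_eq0 map_poly_eq0.
  by rewrite -(dvdpZr _ _ c0) -rE dvdp_map.
case/dvdp_prod_XsubC => m; rewrite eqp_monic ?map_monic ?monic_prod_XsubC //.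
(* The mask is replaced by one of length [size r], so that it occurs among the tuples of [S]. *)
move=> /eqP ->; have /subseqP[m' sm ->] := mask_subseq m r.
have {}sm : size m' == size r by apply/eqP.
by apply/mapP; exists (Tuple sm); rewrite ?mem_enum.
Qed.

(** Coprimality gives x^z1 A = M l2 and x^z2 B = - M l4. The false flag among [x1], [x2] makes M
    constant by degree, and the true flag among [z1], [z2] gives M(0) = 0. *)
Lemma cross_dash_inj (F : fieldType) (z1 z2 x1 x2 : bool) n1 n2
    (A B l2 l4 : {poly F}) :
  size l2 = n1.+1 -> size l4 = n2.+1 -> l2`_0 != 0 -> l4`_0 != 0 ->
  coprimep l2 l4 ->
  (size ('X^z1 * A)%R <= (n1 + x1).+1)%N -> (size ('X^z2 * B)%R <= (n2 + x2).+1)%N ->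
  ~~ (x1 && x2) -> z1 || z2 ->
  cross z1 z2 (A, l2) (B, l4) = 0 -> A = 0 /\ B = 0.
Proof.
move=> s2 s4 l20 l40 cc sA sB x12 z12 e.
have e' : 'X^z1 * A * l4 + l2 * ('X^z2 * B) = 0.
  by rewrite -(mulXn_cross z1 z2 (A, l2) (B, l4)) e mulr0.
have l2n : l2 != 0 by apply: contra_neq l20 => ->; rewrite coef0.
have l4n : l4 != 0 by apply: contra_neq l40 => ->; rewrite coef0.
have /dvdpP[M AE] : l2 %| 'X^z1 * A.
  rewrite -(Gauss_dvdpl _ cc); apply/dvdpP; exists (- ('X^z2 * B)).
  by apply/eqP; rewrite -subr_eq0 mulNr opprK [_ * l2]mulrC e'.
have BE : 'X^z2 * B = - M * l4.
  apply: (mulfI l2n); apply/eqP; rewrite -subr_eq0 -e' AE; apply/eqP; ring.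
have M0 : M`_0 = 0.
  have h1 : ('X^z1 * A)`_0 = (M * l2)`_0 by rewrite AE.
  have h2 : ('X^z2 * B)`_0 = (- M * l4)`_0 by rewrite BE.
  move: h1 h2; rewrite !coefXnM0 !coef0M coefN.
  case: z1 z2 z12 {sA sB e e' AE BE} => [] [] //= _; rewrite ?mulr0n.
  - by move=> /esym/eqP; rewrite mulf_eq0 (negPf l20) orbF => /eqP.
  - by move=> /esym/eqP; rewrite mulf_eq0 (negPf l20) orbF => /eqP.
  - by move=> _ /esym/eqP; rewrite mulf_eq0 (negPf l40) orbF oppr_eq0 => /eqP.
have MM : M = 0.
  apply: contraTeq isT => Mn0.
  have sM : size M = 1%N.
    have sM0 : (0 < size M)%N by rewrite size_poly_gt0.
    have e1 : size ('X^z1 * A) = (size M + n1)%N by rewrite AE size_mul // s2 addnS.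
    have e2 : size ('X^z2 * B) = (size M + n2)%N.
      by rewrite BE size_mul ?oppr_eq0 // size_polyN s4 addnS.
    move: sA sB; rewrite e1 e2; move: (size M) sM0 => k.
    by move: x12; clear; case: x1; case: x2 => //= _; lia.
  have [c c0 Mc] : exists2 c, c != 0 & M = c%:P by apply/size_poly1P; rewrite sM.
  by move: M0; rewrite Mc coefC /= => /eqP; rewrite (negPf c0).
have Xn (b : bool) : 'X^b != 0 :> {poly F} by rewrite monic_neq0 ?monicXn.
split; [apply: (mulfI (Xn z1))|apply: (mulfI (Xn z2))].
  by rewrite AE MM mul0r mulr0.
by rewrite BE MM oppr0 mul0r mulr0.
Qed.

(** As x does not divide both, coprimality shows that x^z1 m1 divides A and x^z2 m3 divides B. A
    true flag among [x1], [x2] makes one divisor exceed the degree bound, so that A or B vanishes,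
    and the equation kills the other. *)
Lemma cross_spring_inj (F : fieldType) (z1 z2 x1 x2 : bool) n1 n2
    (A B m1 m3 : {poly F}) :
  size ('X^z1 * m1) = (n1 + x1).+1 -> size ('X^z2 * m3) = (n2 + x2).+1 ->
  m1`_0 != 0 -> m3`_0 != 0 -> coprimep m1 m3 ->
  (size A <= n1.+1)%N -> (size B <= n2.+1)%N ->
  x1 || x2 -> ~~ (z1 && z2) ->
  cross z1 z2 (m1, A) (m3, B) = 0 -> A = 0 /\ B = 0.
Proof.
move=> s1 s3 m10 m30 cc sA sB x12 z12 e.
have e' : 'X^z1 * m1 * B + A * ('X^z2 * m3) = 0.
  by rewrite -(mulXn_cross z1 z2 (m1, A) (m3, B)) e mulr0.
have l1n : 'X^z1 * m1 != 0 by rewrite -size_poly_gt0 s1.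
have l3n : 'X^z2 * m3 != 0 by rewrite -size_poly_gt0 s3.
have {}cc : coprimep ('X^z1 * m1) ('X^z2 * m3).
  rewrite -gcdp_eqp1; apply: eqp_trans (gcdp_mulXn z1 z2 m10 m30 cc) _.
  by rewrite (negPf z12) expr0 eqpxx.
have d1 : 'X^z1 * m1 %| A.
  rewrite -(Gauss_dvdpl _ cc); apply/dvdpP; exists (- B).
  by apply/eqP; rewrite -subr_eq0 mulNr opprK [B * _]mulrC addrC e'.
have d3 : 'X^z2 * m3 %| B.
  rewrite coprimep_sym in cc; rewrite -(Gauss_dvdpl _ cc); apply/dvdpP; exists (- A).
  by apply/eqP; rewrite -subr_eq0 mulNr opprK [B * _]mulrC e'.
have big (p q : {poly F}) : p %| q -> (size q < size p)%N -> q = 0.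
  move=> pq; apply: contraTeq => q0; rewrite -leqNgt; exact: dvdp_leq.
case: x1 x12 s1 => [_|/= x2T] s1.
  have A0 : A = 0 by apply: big d1 _; rewrite s1 addn1 ltnS.
  split => //; move: e'; rewrite A0 mul0r addr0 => /eqP.
  by rewrite mulf_eq0 (negPf l1n) => /eqP.
have B0 : B = 0 by apply: big d3 _; rewrite s3 x2T addn1 ltnS.
split => //; move: e'; rewrite B0 mulr0 add0r => /eqP.
by rewrite mulf_eq0 (negPf l3n) orbF => /eqP.
Qed.

(* By [nparams_gap], equality of the numbers of parameters and coefficients. *)
Definition tight (N : network) : bool :=
  (nparams N + no_const N == 2 * sigma_order N + 1 + excess N)%N.

(** The slack in [nparams_gap] is the sum of the slacks of the parts, plus one if both flags e are
    set, plus one if neither flag z is set. *)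
Lemma tight_par N1 N2 : tight (Par N1 N2) =
  [&& tight N1, tight N2, ~~ (excess N1 && excess N2) & no_const N1 || no_const N2].
Proof.
have := nparams_gap N1; have := nparams_gap N2; rewrite /tight /=.
by case: (no_const N1); case: (no_const N2); case: (excess N1);
  case: (excess N2) => /=; lia.
Qed.

(** Here the slack grows by one if neither flag e is set, and by one if both flags z are set. *)
Lemma tight_ser N1 N2 : tight (Ser N1 N2) =
  [&& tight N1, tight N2, excess N1 || excess N2 & ~~ (no_const N1 && no_const N2)].
Proof.
have := nparams_gap N1; have := nparams_gap N2.
have := no_const_le N1; have := no_const_le N2; rewrite /tight /=.
by case: (no_const N1); case: (no_const N2); case: (excess N1);
  case: (excess N2) => /=; lia.
Qed.

Lemma cross_scale (F : fieldType) z1 z2 (a b : F) (p1 p2 : {poly F} * {poly F}) :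
  cross z1 z2 (a *: p1.1, a *: p1.2) (b *: p2.1, b *: p2.2) =
  (a * b) *: cross z1 z2 p1 p2.
Proof.
rewrite /cross /= scalerDr -!scalerAl -!scalerAr !scalerA.
by congr (_ + _ *: _); rewrite mulrC.
Qed.

Lemma cross_sub_spring (F : fieldType) z1 z2 (m m' l n n' h : {poly F}) :
  cross z1 z2 (m - m', l) (n - n', h) =
  cross z1 z2 (m, l) (n, h) - cross z1 z2 (m', l) (n', h).
Proof. by rewrite /cross /=; ring. Qed.

Lemma cross_sub_dash (F : fieldType) z1 z2 (m l l' n h h' : {poly F}) :
  cross z1 z2 (m, l - l') (n, h - h') =
  cross z1 z2 (m, l) (n, h) - cross z1 z2 (m, l') (n, h').
Proof. by rewrite /cross /=; ring. Qed.

(** Converse to [cross_coprime_dash], by the same reduction modulo each factor: it passes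
    coprimality from a network down to its parts. *)
Lemma coprime_cross_dash (F : fieldType) z1 z2 (p1 p2 : {poly F} * {poly F}) :
  coprimep (cross z1 z2 p1 p2) (p1.2 * p2.2) ->
  [/\ coprimep p1.1 p1.2, coprimep p2.1 p2.2 & coprimep p1.2 p2.2].
Proof.
rewrite coprimepMr => /andP[]; rewrite coprimep_sym => c1.
rewrite coprimep_sym => c2; move: c1 c2.
rewrite coprimep_addr_dvdp ?dvdp_mul2 // coprimep_addl_dvdp ?dvdp_mul2 //.
rewrite !coprimepMr => /and3P[_ c11 ->] /and3P[_ c22 _].
by split=> //; rewrite coprimep_sym.
Qed.

Lemma coprime_cross_spring (F : fieldType) z1 z2 (p1 p2 : {poly F} * {poly F}) :
  coprimep (p1.1 * p2.1) (cross z1 z2 p1 p2) ->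
  [/\ coprimep p1.1 p1.2, coprimep p2.1 p2.2 & coprimep p1.1 p2.1].
Proof.
rewrite coprimepMl /cross (mulrC p1.1) (mulrC p2.1) => /andP[].
rewrite coprimep_addl_dvdp ?dvdp_mul2 // coprimep_addr_dvdp ?dvdp_mul2 //.
by rewrite !coprimepMr => /and3P[_ -> ->] /and3P[_ -> _].
Qed.

Lemma finite_fibers (U V : Type) (F : set U) (phi : U -> V) (D : set V) :
  finite_set D -> (forall u, F u -> D (phi u)) ->
  (forall u, F u -> finite_set [set u' | F u' /\ phi u' = phi u]) -> finite_set F.
Proof.
move=> fD FD fF.
apply: (@sub_finite_set _ _ (\bigcup_(d in D) [set u | F u /\ phi u = d])).
  by move=> u Fu; exists (phi u); [exact: FD|split].
apply: bigcup_finite => // d _.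
have [[u [Fu <-]]|n] := pselect (exists u, F u /\ phi u = d); first exact: fF.
suff -> : [set u | F u /\ phi u = d] = set0 by exact: finite_set0.
by apply/seteqP; split=> // u /= h; apply: n; exists u.
Qed.

(** The fiber of the coefficient map in the form given by [coef_map_eqP], over functions instead of
    tuples. *)
Definition core_fiber (R : realType) N (t : 'I_(nparams N) -> R) :
    set ('I_(nparams N) -> R) :=
  [set u | (forall i, 0 < u i) /\
     exists2 k, k != 0 & core u = (k *: (core t).1, k *: (core t).2)].

Lemma size_core_mulXn (R : realType) N (v : 'I_(nparams N) -> R) :
  (forall i, 0 < v i) ->
  size ('X^(no_const N) * (core v).1) = (sigma_order N + excess N).+1.
Proof.
move=> v0; have [_ _ l _ [_ s]] := core_pos v0.
rewrite size_monicM ?monicXn ?size_polyXn -?lead_coef_eq0 ?gt_eqF //.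
by rewrite addSn addnC.
Qed.

(** Once [(core u1).2] is known up to the scalar [a], the product fixes [(core u2).2] up to [k / a].
    The rescaled differences [A] and [B] of the first components then lie in the kernel that
    [cross_dash_inj] shows to be trivial. *)
Lemma par_core_unique (R : realType) N1 N2
    (u1 v1 : 'I_(nparams N1) -> R) (u2 v2 : 'I_(nparams N2) -> R) (k a : R) :
  (forall i, 0 < u1 i) -> (forall i, 0 < u2 i) ->
  (forall i, 0 < v1 i) -> (forall i, 0 < v2 i) ->
  ~~ (excess N1 && excess N2) -> no_const N1 || no_const N2 ->
  coprimep (core v1).2 (core v2).2 -> k != 0 -> a != 0 ->
  cross (no_const N1) (no_const N2) (core u1) (core u2) =
    k *: cross (no_const N1) (no_const N2) (core v1) (core v2) ->
  (core u1).2 * (core u2).2 = k *: ((core v1).2 * (core v2).2) ->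
  (core u1).2 = a *: (core v1).2 ->
  core u1 = (a *: (core v1).1, a *: (core v1).2) /\
  core u2 = ((k / a) *: (core v2).1, (k / a) *: (core v2).2).
Proof.
move=> u10 u20 v10 v20 x12 z12 cc k0 a0 eS eL e1.
have su1 := size_core_mulXn u10; have su2 := size_core_mulXn u20.
have sv1 := size_core_mulXn v10; have sv2 := size_core_mulXn v20.
have [_ /gt_eqF/negbT l1 _ _ [s1 _]] := core_pos v10.
have [_ /gt_eqF/negbT l2 _ _ [s2 _]] := core_pos v20.
have l1n : (core v1).2 != 0 by rewrite -size_poly_gt0 s1.
have b0 : k / a != 0 by rewrite mulf_neq0 ?invr_eq0.
have e2 : (core u2).2 = (k / a) *: (core v2).2.
  apply: (scalerI a0); apply: (mulfI l1n).
  rewrite scalerA mulrCA mulfV // mulr1 -[RHS]scalerAr -eL e1.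
  by rewrite -scalerAl -scalerAr.
have ab : a * (k / a) = k by rewrite mulrCA mulfV // mulr1.
pose A := a^-1 *: (core u1).1 - (core v1).1.
pose B := (k / a)^-1 *: (core u2).1 - (core v2).1.
have eC : cross (no_const N1) (no_const N2) (A, (core v1).2) (B, (core v2).2) = 0.
  rewrite cross_sub_spring.
  have -> : (core v1).2 = a^-1 *: (core u1).2 by rewrite e1 scalerA mulVf ?scale1r.
  have -> : (core v2).2 = (k / a)^-1 *: (core u2).2.
    by rewrite e2 scalerA mulVf ?scale1r.
  rewrite cross_scale eS scalerA -invfM ab mulVf // scale1r.
  rewrite e1 e2 !scalerA !mulVf // !scale1r.
  by rewrite -!surjective_pairing subrr.
have sB (p q : {poly R}) n : (size p <= n)%N -> (size q <= n)%N ->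
    (size (p - q)%R <= n)%N.
  by move=> hp hq; rewrite (leq_trans (size_polyD _ _)) // size_polyN geq_max hp hq.
have [A0 B0] : A = 0 /\ B = 0.
  apply: (cross_dash_inj s1 s2 l1 l2 cc _ _ x12 z12 eC).
    rewrite mulrBr -scalerAr; apply: sB; last by rewrite sv1.
    by rewrite (leq_trans (size_scale_leq _ _)) // su1.
  rewrite mulrBr -scalerAr; apply: sB; last by rewrite sv2.
  by rewrite (leq_trans (size_scale_leq _ _)) // su2.
split; [rewrite -e1|rewrite -e2].
  rewrite [LHS]surjective_pairing; congr (_, _).
  apply: (scalerI (_ : a^-1 != 0)); first by rewrite invr_eq0.
  by rewrite scalerA mulVf // scale1r; apply/eqP; rewrite -subr_eq0 -/A A0.
rewrite [LHS]surjective_pairing; congr (_, _).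
apply: (scalerI (_ : (k / a)^-1 != 0)); first by rewrite invr_eq0.
by rewrite scalerA mulVf // scale1r; apply/eqP; rewrite -subr_eq0 -/B B0.
Qed.

(** Dual to [par_core_unique], with the first components known and [cross_spring_inj] for the second
    ones. *)
Lemma ser_core_unique (R : realType) N1 N2
    (u1 v1 : 'I_(nparams N1) -> R) (u2 v2 : 'I_(nparams N2) -> R) (k a : R) :
  (forall i, 0 < u1 i) -> (forall i, 0 < u2 i) ->
  (forall i, 0 < v1 i) -> (forall i, 0 < v2 i) ->
  excess N1 || excess N2 -> ~~ (no_const N1 && no_const N2) ->
  coprimep (core v1).1 (core v2).1 -> k != 0 -> a != 0 ->
  (core u1).1 * (core u2).1 = k *: ((core v1).1 * (core v2).1) ->
  cross (no_const N1) (no_const N2) (core u1) (core u2) =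
    k *: cross (no_const N1) (no_const N2) (core v1) (core v2) ->
  (core u1).1 = a *: (core v1).1 ->
  core u1 = (a *: (core v1).1, a *: (core v1).2) /\
  core u2 = ((k / a) *: (core v2).1, (k / a) *: (core v2).2).
Proof.
move=> u10 u20 v10 v20 x12 z12 cc k0 a0 eL eS e1.
have sv1 := size_core_mulXn v10; have sv2 := size_core_mulXn v20.
have [/gt_eqF/negbT l1 _ /gt_eqF/negbT + _ [s1 _]] := core_pos v10.
rewrite lead_coef_eq0 => l1n.
have [/gt_eqF/negbT l2 _ _ _ [s2 _]] := core_pos v20.
have [_ _ _ _ [t1 _]] := core_pos u10; have [_ _ _ _ [t2 _]] := core_pos u20.
have b0 : k / a != 0 by rewrite mulf_neq0 ?invr_eq0.
have e2 : (core u2).1 = (k / a) *: (core v2).1.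
  apply: (scalerI a0); apply: (mulfI l1n).
  rewrite scalerA mulrCA mulfV // mulr1 -[RHS]scalerAr -eL e1.
  by rewrite -scalerAl -scalerAr.
have ab : a * (k / a) = k by rewrite mulrCA mulfV // mulr1.
pose A := a^-1 *: (core u1).2 - (core v1).2.
pose B := (k / a)^-1 *: (core u2).2 - (core v2).2.
have eC : cross (no_const N1) (no_const N2) ((core v1).1, A) ((core v2).1, B) = 0.
  rewrite cross_sub_dash.
  have -> : (core v1).1 = a^-1 *: (core u1).1 by rewrite e1 scalerA mulVf ?scale1r.
  have -> : (core v2).1 = (k / a)^-1 *: (core u2).1.
    by rewrite e2 scalerA mulVf ?scale1r.
  rewrite cross_scale eS scalerA -invfM ab mulVf // scale1r.
  rewrite e1 e2 !scalerA !mulVf // !scale1r.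
  by rewrite -!surjective_pairing subrr.
have sB (p q : {poly R}) n : (size p <= n)%N -> (size q <= n)%N ->
    (size (p - q)%R <= n)%N.
  by move=> hp hq; rewrite (leq_trans (size_polyD _ _)) // size_polyN geq_max hp hq.
have [A0 B0] : A = 0 /\ B = 0.
  apply: (cross_spring_inj sv1 sv2 l1 l2 cc _ _ x12 z12 eC).
    apply: sB; last by rewrite s1.
    by rewrite (leq_trans (size_scale_leq _ _)) // t1.
  apply: sB; last by rewrite s2.
  by rewrite (leq_trans (size_scale_leq _ _)) // t2.
split; [rewrite -e1|rewrite -e2].
  rewrite [LHS]surjective_pairing; congr (_, _).
  apply: (scalerI (_ : a^-1 != 0)); first by rewrite invr_eq0.
  by rewrite scalerA mulVf // scale1r; apply/eqP; rewrite -subr_eq0 -/A A0.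
rewrite [LHS]surjective_pairing; congr (_, _).
apply: (scalerI (_ : (k / a)^-1 != 0)); first by rewrite invr_eq0.
by rewrite scalerA mulVf // scale1r; apply/eqP; rewrite -subr_eq0 -/B B0.
Qed.

Definition monicized (F : fieldType) (p : {poly F}) := (lead_coef p)^-1 *: p.

Lemma monicized_monic (F : fieldType) (p : {poly F}) : p != 0 -> monicized p \is monic.
Proof. by move=> p0; rewrite monicE lead_coefZ mulVf // lead_coef_eq0. Qed.

Lemma monicized_eq (F : fieldType) (p q : {poly F}) :
  p != 0 -> q != 0 -> monicized p = monicized q -> exists2 a, a != 0 & p = a *: q.
Proof.
move=> p0 q0 e; exists (lead_coef p / lead_coef q).
  by rewrite mulf_neq0 ?invr_eq0 ?lead_coef_eq0.
by rewrite -scalerA -/(monicized q) -e scalerA mulfV ?scale1r // lead_coef_eq0.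
Qed.

Lemma core_fiber_trans (R : realType) N (t u u' : 'I_(nparams N) -> R) :
  core_fiber t u -> core_fiber t u' -> core_fiber u u'.
Proof.
move=> [_ [k k0 e]] [u'0 [k' k'0 e']]; split=> //; exists (k' / k).
  by rewrite mulf_neq0 ?invr_eq0.
by rewrite e e' /= !scalerA mulfVK.
Qed.

Lemma core_neq0 (R : realType) N (u : 'I_(nparams N) -> R) :
  (forall i, 0 < u i) -> (core u).1 != 0 /\ (core u).2 != 0.
Proof.
by move=> /core_pos[_ _ a b _]; rewrite -!lead_coef_eq0 !gt_eqF.
Qed.

Lemma core_fiber_coprime (R : realType) N (t u : 'I_(nparams N) -> R) :
  core_fiber t u -> coprimep (core t).1 (core t).2 -> coprimep (core u).1 (core u).2.
Proof. by move=> [_ [k k0 ->]] /=; rewrite coprimepZl // coprimepZr. Qed.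

Lemma finite_leaf_fiber (R : realType) (t : 'I_1 -> R) :
  finite_set [set u : 'I_1 -> R | (forall i, 0 < u i) /\
    exists2 k, k != 0 &
      ((u ord0)%:P, 1) = (k *: (t ord0)%:P, k *: 1) :> {poly R} * {poly R}].
Proof.
apply: (@sub_finite_set _ _ [set t]); last exact: finite_set1.
move=> u [_ [k k0 [e1 e2]]] /=; apply/funext => i; rewrite ord1.
have k1 : k = 1 by have /polyP/(_ 0) := e2; rewrite coefZ coef1 mulr1.
by have /polyP/(_ 0) := e1; rewrite k1 scale1r !coefC.
Qed.

Lemma finite_core_fiber (R : realType) N (t : 'I_(nparams N) -> R) :
  tight N -> (forall i, 0 < t i) -> coprimep (core t).1 (core t).2 ->
  finite_set (core_fiber t).
Proof.
elim: N t => [||N1 IH1 N2 IH2|N1 IH1 N2 IH2] t.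
- by move=> _ _ _; apply: finite_leaf_fiber.
- by move=> _ _ _; apply: finite_leaf_fiber.
- rewrite tight_par => /and4P[T1 T2 x12 z12] t0 ct.
  have [_ t2n] := core_neq0 t0.
  (* The fiber is partitioned by the monic divisor of L' that the left part contributes. *)
  apply: (finite_fibers (phi := fun u => monicized (core (lpart u)).2)
    (finite_monic_divisors t2n)) => [u [u0 [k k0 e]]|u Fu].
    have [_ n1] := core_neq0 (fun i => u0 (lshift _ i) : 0 < lpart u i).
    split; first exact: monicized_monic.
    rewrite dvdpZl ?invr_eq0 ?lead_coef_eq0 // -(dvdpZr _ _ k0).
    by move: e => /= [_ <-]; apply: dvdp_mulr.
  have [u0 _] := Fu; have := core_fiber_coprime Fu ct.
  have u10 i : 0 < lpart u i by exact: u0.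
  have u20 i : 0 < rpart u i by exact: u0.
  move=> /coprime_cross_dash[c1 c2 c12].
  (* Each class will lie in the image under [glue] of the fibers of the two parts, both finite by
     induction. *)
  have fin := finite_image2 (@glue R _ _) (IH1 _ T1 u10 c1) (IH2 _ T2 u20 c2).
  apply: sub_finite_set fin => u' [Fu' em].
  (* Proportionality is recentred from [t] to [u], whose parts have coprime cores. *)
  have [u'0 [k k0 /= [eS eL]]] := core_fiber_trans Fu Fu'.
  have u'10 i : 0 < lpart u' i by exact: u'0.
  have u'20 i : 0 < rpart u' i by exact: u'0.
  have [a a0 ea] := monicized_eq (core_neq0 u'10).2 (core_neq0 u10).2 em.
  have [e1 e2] := par_core_unique u'10 u'20 u10 u20 x12 z12 c12 k0 a0 eS eL ea.
  exists (lpart u'); first by split=> //; exists a.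
  exists (rpart u'); last exact: glue_parts.
  by split=> //; exists (k / a); rewrite ?mulf_neq0 ?invr_eq0.
- rewrite tight_ser => /and4P[T1 T2 x12 z12] t0 ct.
  have [t1n _] := core_neq0 t0.
  apply: (finite_fibers (phi := fun u => monicized (core (lpart u)).1)
    (finite_monic_divisors t1n)) => [u [u0 [k k0 e]]|u Fu].
    have [n1 _] := core_neq0 (fun i => u0 (lshift _ i) : 0 < lpart u i).
    split; first exact: monicized_monic.
    rewrite dvdpZl ?invr_eq0 ?lead_coef_eq0 // -(dvdpZr _ _ k0).
    by move: e => /= [<- _]; apply: dvdp_mulr.
  have [u0 _] := Fu; have := core_fiber_coprime Fu ct.
  have u10 i : 0 < lpart u i by exact: u0.
  have u20 i : 0 < rpart u i by exact: u0.
  move=> /coprime_cross_spring[c1 c2 c12].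
  have fin := finite_image2 (@glue R _ _) (IH1 _ T1 u10 c1) (IH2 _ T2 u20 c2).
  apply: sub_finite_set fin => u' [Fu' em].
  have [u'0 [k k0 /= [eL eS]]] := core_fiber_trans Fu Fu'.
  have u'10 i : 0 < lpart u' i by exact: u'0.
  have u'20 i : 0 < rpart u' i by exact: u'0.
  have [a a0 ea] := monicized_eq (core_neq0 u'10).1 (core_neq0 u10).1 em.
  have [e1 e2] := ser_core_unique u'10 u'20 u10 u20 x12 z12 c12 k0 a0 eL eS ea.
  exists (lpart u'); first by split=> //; exists a.
  exists (rpart u'); last exact: glue_parts.
  by split=> //; exists (k / a); rewrite ?mulf_neq0 ?invr_eq0.
Qed.

(** * Infinite fibers from Euler polygons *)

(** Induction along the ring operations, so that the estimates below need only constants, variables,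
    sums and products. *)
Lemma mpoly_ring_ind (R : comNzRingType) n (P : {mpoly R[n]} -> Prop) :
  (forall c, P c%:MP) -> (forall i, P 'X_i) ->
  (forall p q, P p -> P q -> P (p + q)) -> (forall p q, P p -> P q -> P (p * q)) ->
  forall p, P p.
Proof.
move=> PC PX PD PM; elim/mpolyind => [|c m p _ _ Pp]; first by rewrite -mpolyC0.
apply: PD => //; rewrite -mul_mpolyC; apply: (PM) => //; rewrite mpolyXE_id.
elim/big_ind: _ => [||i _]; [by rewrite -mpolyC1|exact: PM|].
by elim: (m i) => [|k IH]; rewrite ?expr0 -?mpolyC1 // exprS; apply: PM.
Qed.

Lemma meval_bounded (R : realType) n (p : {mpoly R[n]}) (rho : R) :
  exists2 C, 0 <= C & forall y : 'I_n -> R, (forall i, `|y i| <= rho) -> `|p.@[y]| <= C.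
Proof.
elim/mpoly_ring_ind: p => [c|i|p q [C C0 IHp] [D D0 IHq]|p q [C C0 IHp] [D D0 IHq]].
- by exists `|c| => // y _; rewrite mevalC.
- exists `|rho| => // y yr; rewrite mevalXU; exact: le_trans (yr i) (ler_norm _).
- exists (C + D) => [|y yr]; first exact: addr_ge0.
  by rewrite mevalD (le_trans (ler_normD _ _)) // lerD ?IHp ?IHq.
- exists (C * D) => [|y yr]; first exact: mulr_ge0.
  by rewrite mevalM normrM ler_pM ?IHp ?IHq.
Qed.

Definition dirderiv (R : comNzRingType) n (z : 'I_n -> R) (p : {mpoly R[n]})
    (y : 'I_n -> R) :=
  \sum_i z i * (p^`M(i)).@[y].

(** First-order expansion with a remainder uniform over a box, proved algebraically: a product
    inherits it from its factors. *)
Lemma meval_taylor (R : realType) n (p : {mpoly R[n]}) (rho : R) :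
  exists2 C, 0 <= C & forall (y z : 'I_n -> R) (d : R),
    (forall i, `|y i| <= rho) -> (forall i, `|z i| <= rho) -> `|d| <= 1 ->
    `|p.@[fun i => y i + d * z i] - p.@[y] - d * dirderiv z p y| <= C * d ^+ 2.
Proof.
elim/mpoly_ring_ind: p => [c|i|p q [C C0 IHp] [D D0 IHq]|p q [C C0 IHp] [D D0 IHq]].
- exists 0 => // y z d _ _ _; rewrite /dirderiv !mevalC subrr.
  rewrite big1 ?mulr0 ?subr0 ?normr0 ?mul0r //.
  by move=> i _; rewrite mderivC meval0 mulr0.
- exists 0 => // y z d _ _ _; rewrite !mevalXU.
  have -> : dirderiv z 'X_i y = z i.
    rewrite /dirderiv (bigD1 i) //= big1 ?addr0 => [|j ji].
      have -> : 'X_i^`M(i) = 1 :> {mpoly R[n]}.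
        rewrite mderivX mnmE eqxx scale1r -mpolyX0; congr 'X_[_].
        by apply/mnmP => j; rewrite mnmBE subnn mnm0E.
      by rewrite meval1 mulr1.
    by rewrite mderivX mnmE eq_sym (negPf ji) scale0r meval0 mulr0.
  by rewrite [_ + d * _]addrC addrK subrr normr0 mul0r.
- exists (C + D) => [|y z d yr zr d1]; first exact: addr_ge0.
  have -> : dirderiv z (p + q) y = dirderiv z p y + dirderiv z q y.
    by rewrite /dirderiv -big_split; apply: eq_bigr => i _; rewrite mderivD mevalD mulrDr.
  rewrite !mevalD mulrDl.
  have := IHp y z d yr zr d1; have := IHq y z d yr zr d1.
  set a := (X in `|X| <= D * _); set b := (X in `|X| <= C * _) => ha hb.
  have -> : p.@[fun i => y i + d * z i] + q.@[fun i => y i + d * z i] -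
    (p.@[y] + q.@[y]) -
    d * (dirderiv z p y + dirderiv z q y) = b + a by rewrite /a /b; ring.
  by rewrite (le_trans (ler_normD _ _)) // lerD.
(* The doubled radius covers every y + e z with [|e| <= 1]. *)
- have [Bp Bp0 hBp] := meval_bounded p (rho + rho).
  have [Bq Bq0 hBq] := meval_bounded q (rho + rho).
  pose Dp := Bp + Bp + C; pose Dq := Bq + Bq + D.
  have dd0 : 0 <= Dp by rewrite !addr_ge0.
  have dd1 : 0 <= Dq by rewrite !addr_ge0.
  exists (C * Bq + (Bp + Dp) * D + Dp * Dq) => [|y z d yr zr d1].
    by rewrite !addr_ge0 ?mulr_ge0 ?addr_ge0.
  have yr2 i : `|y i| <= rho + rho.
    by rewrite (le_trans (yr i)) // lerDl (le_trans _ (yr i)).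
  have yzr (e : R) : `|e| <= 1 -> forall i, `|y i + e * z i| <= rho + rho.
    move=> e1 i; rewrite (le_trans (ler_normD _ _)) // lerD // normrM.
    by rewrite (le_trans (ler_piMl _ e1)).
  (* The estimate at d = 1 bounds the derivative itself, as a difference of two values and a
     remainder. *)
  have bd (r : {mpoly R[n]}) B E :
      (forall y, (forall i, `|y i| <= rho + rho) -> `|r.@[y]| <= B) ->
      (forall (y z : 'I_n -> R) (d : R), (forall i, `|y i| <= rho) ->
      (forall i, `|z i| <= rho) -> `|d| <= 1 ->
      `|r.@[fun i => y i + d * z i] - r.@[y] - d * dirderiv z r y| <= E * d ^+ 2) ->
      `|dirderiv z r y| <= B + B + E.
    move=> hB hE; have := hE y z 1 yr zr; rewrite normr1 lexx => /(_ isT).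
    rewrite expr1n mulr1 mul1r; set a := r.@[_] => h.
    have ha : `|a| <= B by apply/hB/yzr; rewrite normr1.
    have -> : dirderiv z r y = a - r.@[y] - (a - r.@[y] - dirderiv z r y) by ring.
    rewrite (le_trans (ler_normB _ _)) // lerD //.
    by rewrite (le_trans (ler_normB _ _)) // lerD // hB.
  have hDp := bd p Bp C hBp IHp; have hDq := bd q Bq D hBq IHq.
  have -> : dirderiv z (p * q) y = dirderiv z p y * q.@[y] + p.@[y] * dirderiv z q y.
    rewrite /dirderiv mulr_suml mulr_sumr -big_split; apply: eq_bigr => i _ /=.
    by rewrite mderivM mevalD !mevalM mulrDr mulrA [_ * (p.@[y] * _)]mulrCA.
  rewrite !mevalM.
  have := IHp y z d yr zr d1; have := IHq y z d yr zr d1.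
  have := hBq _ (yzr d d1); have := hBp _ yr2; move: hDp hDq.
  move: (p.@[fun i => _]) (q.@[fun i => _]) (p.@[y]) (q.@[y]).
  move: (dirderiv z p y) (dirderiv z q y) => da db a' b' a b.
  move=> hda hdb ha hb' heb hea.
  (* The remainder of the product splits into the remainders of the two factors and the second-order
     term from both derivatives. *)
  have -> : a' * b' - a * b - d * (da * b + a * db) =
    (a' - a - d * da) * b' + (a + d * da) * (b' - b - d * db) + d ^+ 2 * (da * db).
    by ring.
  have h1 : `|(a' - a - d * da) * b'| <= C * Bq * d ^+ 2.
    by rewrite normrM mulrAC ler_pM.
  have h2 : `|(a + d * da) * (b' - b - d * db)| <= (Bp + Dp) * D * d ^+ 2.
    rewrite normrM -mulrA ler_pM // (le_trans (ler_normD _ _)) // lerD // normrM.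
    by rewrite (le_trans (ler_piMl _ d1)).
  have h3 : `|d ^+ 2 * (da * db)| <= Dp * Dq * d ^+ 2.
    rewrite mulrC normrM [`|da * db|]normrM (ger0_norm (sqr_ge0 d)) ler_wpM2r ?sqr_ge0 //.
    by rewrite ler_pM.
  rewrite (le_trans (ler_normD _ _)) // [leRHS]mulrDl lerD //.
  by rewrite (le_trans (ler_normD _ _)) // [leRHS]mulrDl lerD.
Qed.

(** Taylor expansion along z = (y - t) / d, whose entries are at most 1 and hence at most [rho]. *)
Lemma meval_lipschitz (R : realType) n (p : {mpoly R[n]}) (t : 'I_n -> R) :
  exists2 C, 0 <= C & forall (d : R) (y : 'I_n -> R), 0 < d <= 1 ->
    (forall i, `|y i - t i| <= d) -> `|p.@[y] - p.@[t]| <= C * d.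
Proof.
pose rho := 1 + \sum_i `|t i|.
have trho i : `|t i| <= rho.
  by rewrite /rho (bigD1 i) //= addrCA lerDl addr_ge0 // sumr_ge0.
have rho1 : 1 <= rho by rewrite lerDl sumr_ge0.
have [B B0 hB] := meval_bounded p (rho + rho).
have [C C0 hC] := meval_taylor p rho.
exists (B + B + C + C) => [|d y /andP[d0 d1] yt]; first by rewrite !addr_ge0.
pose z i := (y i - t i) / d.
have zr i : `|z i| <= rho.
  rewrite normrM normfV (gtr0_norm d0) ler_pdivrMr // (le_trans (yt i)) //.
  by rewrite ler_peMl // ltW.
have yE : (fun i => t i + d * z i) =1 y.
  by move=> i; rewrite /z mulrC divfK ?gt_eqF // addrC subrK.
have nd1 : `|d| <= 1 by rewrite gtr0_norm.
have := hC t z 1 trho zr; rewrite normr1 lexx => /(_ isT).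
rewrite expr1n mulr1 mul1r => h1.
have hdd : `|dirderiv z p t| <= B + B + C.
  set a := p.@[_] in h1.
  have ha : `|a| <= B.
    by apply: hB => i; rewrite mul1r (le_trans (ler_normD _ _)) // lerD.
  have ht : `|p.@[t]| <= B.
    by apply: hB => i; rewrite (le_trans (trho i)) // lerDl (le_trans _ rho1).
  have -> : dirderiv z p t = a - p.@[t] - (a - p.@[t] - dirderiv z p t) by ring.
  by rewrite (le_trans (ler_normB _ _)) // lerD // (le_trans (ler_normB _ _)) // lerD.
have := hC t z d trho zr nd1; rewrite (meval_eq _ yE) => h2.
have -> : p.@[y] - p.@[t] = d * dirderiv z p t + (p.@[y] - p.@[t] - d * dirderiv z p t).
  by ring.
rewrite (le_trans (ler_normD _ _)) // mulrDl lerD //.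
  by rewrite normrM (gtr0_norm d0) mulrC ler_wpM2r // ltW.
rewrite (le_trans h2) // ler_wpM2l // expr2 ler_piMl // ltW //.
Qed.

Lemma meval_locally_bounded_below (R : realType) n (p : {mpoly R[n]}) (t : 'I_n -> R) :
  p.@[t] != 0 -> exists2 r, 0 < r <= 1 & forall y : 'I_n -> R,
    (forall i, `|y i - t i| <= r) -> `|p.@[t]| / 2 <= `|p.@[y]|.
Proof.
move=> p0; have [C C0 hC] := meval_lipschitz p t.
have pt0 : 0 < `|p.@[t]| by rewrite normr_gt0.
(* Chosen so that C r is at most half of [|p.@[t]|]; C + 1 replaces C, which may be 0. *)
pose r := Num.min 1 (`|p.@[t]| / (2 * (C + 1))).
have C1 : 0 < C + 1 by rewrite ltr_wpDl.
have r0 : 0 < r by rewrite lt_min ltr01 divr_gt0 // mulr_gt0.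
have [r1 r2] : r <= 1 /\ r <= `|p.@[t]| / (2 * (C + 1)).
  by rewrite /r !ge_min !lexx orbT.
exists r => [|y yr]; first by rewrite r0.
have := hC r y; rewrite r0 r1 => /(_ isT yr) h.
have Cr : C * r <= `|p.@[t]| / 2.
  have : C * r <= (C + 1) * (`|p.@[t]| / (2 * (C + 1))).
    by apply: (ler_pM C0 (ltW r0) _ r2); rewrite lerDl.
  have -> // : (C + 1) * (`|p.@[t]| / (2 * (C + 1))) = `|p.@[t]| / 2.
  by field; rewrite gt_eqF.
have : `|p.@[t]| <= `|p.@[y] - p.@[t]| + `|p.@[y]|.
  have := ler_normB p.@[y] (p.@[y] - p.@[t]).
  by rewrite subKr addrC.
by move: h Cr; lra.
Qed.

Lemma meval_continuous (R : realType) n (p : {mpoly R[n]}) :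
  continuous (fun x : 'rV[R]_n => p.@[fun i => x ord0 i]).
Proof.
elim/mpoly_ring_ind: p => [c|i|p q IHp IHq|p q IHp IHq] x.
- by under eq_fun do rewrite mevalC; apply: cst_continuous.
- by under eq_fun do rewrite mevalXU; apply: coord_continuous.
- by under eq_fun do rewrite mevalD; exact: cvgD (IHp x) (IHq x).
- by under eq_fun do rewrite mevalM; exact: cvgM (IHp x) (IHq x).
Qed.

Lemma meval_family_bounded (R : realType) n (I : finType)
    (F : I -> {mpoly R[n]}) (rho : R) :
  exists2 C, 0 <= C &
    forall i (y : 'I_n -> R), (forall k, `|y k| <= rho) -> `|(F i).@[y]| <= C.
Proof.
pose B i := s2val (cid2 (meval_bounded (F i) rho)).
have B0 i : 0 <= B i by rewrite /B; case: cid2.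
exists (\sum_i B i) => [|i y yr]; first by rewrite sumr_ge0.
have : `|(F i).@[y]| <= B i by rewrite /B; case: cid2 => C /= _; apply.
by move/le_trans; apply; rewrite (bigD1 i) //= lerDl sumr_ge0.
Qed.

Section Euler.
Variables (R : realType) (n : nat) (J : finType).
Variables (f : J -> {mpoly R[n]}) (j0 : J).
Variables (v : 'I_n -> {mpoly R[n]}) (lam : {mpoly R[n]}).
Variables (t : 'I_n -> R) (i0 : 'I_n).
(** The field [v] acts on every [f j] as multiplication by the same [lam], so the ratios of [f j] to
    [f j0] are constant along its trajectories. *)
Hypothesis Hv : forall j, \sum_i v i * (f j)^`M(i) = lam * f j.
Hypothesis Hf0 : (f j0).@[t] != 0.
Hypothesis Hvt : (v i0).@[t] != 0.
Hypothesis t0 : forall i, 0 < t i.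

Definition close r (y : 'I_n -> R) := forall i, `|y i - t i| <= r.

Definition good r :=
  [/\ 0 < r <= 1, (forall y, close r y -> `|(v i0).@[t]| / 2 <= `|(v i0).@[y]|),
      (forall y, close r y -> `|(f j0).@[t]| / 2 <= `|(f j0).@[y]|) &
      forall y, close r y -> forall i, 0 < y i].

Lemma good_radius : exists r, good r.
Proof.
have [r1 /andP[r10 r11] h1] := meval_locally_bounded_below Hvt.
have [r2 /andP[r20 r21] h2] := meval_locally_bounded_below Hf0.
pose r3 := \big[Order.min/1]_i (t i / 2).
have r30 : 0 < r3 by apply: lt_bigmin => // i _; rewrite divr_gt0.
have r3t i : r3 <= t i / 2 by apply: bigmin_le_cond.
pose r := Num.min r1 (Num.min r2 r3).
have [e1 [e2 e3]] : r <= r1 /\ r <= r2 /\ r <= r3.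
  by rewrite /r !ge_min !lexx !orbT.
exists r; split=> [|y yr|y yr|y yr i].
- by rewrite (le_trans e1 r11) andbT !lt_min r10 r20.
- by apply: h1 => i; apply: le_trans (yr i) e1.
- by apply: h2 => i; apply: le_trans (yr i) e2.
- by have := yr i; have := r3t i; have := t0 i; rewrite ler_norml; lra.
Qed.

(** Dividing by [v i0] turns the coordinate [i0] into time: a step advances it by exactly [d]. *)
Let w (y : 'I_n -> R) i := (v i).@[y] / (v i0).@[y].
Let step d (y : 'I_n -> R) i := y i + d * w y i.
Let c j (y : 'I_n -> R) := (f j).@[y] / (f j0).@[y].

Lemma close_bounded r y : r <= 1 -> close r y ->
  forall i, `|y i| <= 1 + \sum_k `|t k|.
Proof.
move=> r1 yr i; have -> : y i = (y i - t i) + t i by rewrite subrK.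
rewrite (le_trans (ler_normD _ _)) // lerD ?(le_trans (yr i)) //.
by rewrite (bigD1 i) //= lerDl sumr_ge0.
Qed.

Lemma field_bounded r : good r ->
  exists2 W, 1 <= W & forall y, close r y -> forall i, `|w y i| <= W.
Proof.
move=> [/andP[r0 r1] h1 _ _].
have [B B0 hB] := meval_family_bounded v (1 + \sum_k `|t k|).
have e0 : 0 < `|(v i0).@[t]| / 2 by rewrite divr_gt0 ?normr_gt0.
exists (1 + B / (`|(v i0).@[t]| / 2)) => [|y yr i].
  by rewrite lerDl divr_ge0 // ltW.
rewrite normrM normfV; apply: ler_wpDl => //; apply: ler_pM => //.
  exact/hB/(close_bounded r1 yr).
rewrite lef_pV2 ?h1 ?posrE //; exact: lt_le_trans e0 (h1 _ yr).
Qed.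

Lemma dirderiv_field y j : (v i0).@[y] != 0 ->
  dirderiv (w y) (f j) y = lam.@[y] / (v i0).@[y] * (f j).@[y].
Proof.
move=> p0; have := congr1 (meval y) (Hv j).
rewrite mevalM rmorph_sum /= => e.
rewrite mulrAC -e mulr_suml /dirderiv; apply: eq_bigr => i _.
by rewrite mevalM /w mulrAC.
Qed.

(** To first order the numerator and the denominator of [c j] are multiplied by the same factor, so
    the linear terms cancel and the error is quadratic in [d]. *)
Lemma step_error r j : good r -> exists2 C, 0 <= C & forall y d,
  close r y -> close r (step d y) -> `|d| <= 1 ->
  `|c j (step d y) - c j y| <= C * d ^+ 2.
Proof.
move=> gr; have [W W1 hW] := field_bounded gr.
have [/andP[r0 r1] h1 h2 _] := gr.
pose rho := 1 + \sum_k `|t k| + W.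
have s0 : 0 <= \sum_k `|t k| by rewrite sumr_ge0.
have [B B0 hB] := meval_bounded (f j) rho.
have [D D0 hD] := meval_bounded (f j0) rho.
have [C C0 hC] := meval_taylor (f j) rho.
have [E E0 hE] := meval_taylor (f j0) rho.
set m := `|(f j0).@[t]| / 2.
have m0 : 0 < m by rewrite divr_gt0 ?normr_gt0.
have p0 : 0 < `|(v i0).@[t]| / 2 by rewrite divr_gt0 ?normr_gt0.
exists ((C * D + B * E) / (m * m)) => [|y d yr y'r d1].
  by rewrite divr_ge0 ?addr_ge0 ?mulr_ge0 // ltW.
have yb i : `|y i| <= rho.
  by rewrite (le_trans (close_bounded r1 yr i)) // lerDl (le_trans _ W1).
have wb i : `|w y i| <= rho by rewrite (le_trans (hW y yr i)) // lerDr addr_ge0.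
have pn0 : (v i0).@[y] != 0 by rewrite -normr_gt0 (lt_le_trans p0) ?h1.
have := hC y (w y) d yb wb d1; have := hE y (w y) d yb wb d1.
rewrite !dirderiv_field // -/(step d y).
have := hB y yb; have := hD y yb; have := h2 _ yr; have := h2 _ y'r.
rewrite /c -/m.
move: (f j).@[step d y] (f j0).@[step d y] (f j).@[y] (f j0).@[y] => a' b' a b.
move: (lam.@[y] / _) => l hb' hb Hb Ha eb ea.
have b'0 : b' != 0 by rewrite -normr_gt0 (lt_le_trans m0).
have b0 : b != 0 by rewrite -normr_gt0 (lt_le_trans m0).
have -> : a' / b' - a / b =
    ((a' - a - d * (l * a)) * b - a * (b' - b - d * (l * b))) / (b' * b).
  by field; rewrite b0 b'0.
rewrite normrM normfV mulrAC; apply: ler_pM => //; rewrite ?invr_ge0 //.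
  rewrite (le_trans (ler_normB _ _)) // [leRHS]mulrDl lerD // normrM.
    by rewrite mulrAC ler_pM.
  by rewrite -mulrA ler_pM.
have mm : 0 < m * m by exact: mulr_gt0.
rewrite lef_pV2 ?posrE ?normr_gt0 ?mulf_neq0 //.
by rewrite normrM ler_pM // ltW.
Qed.

(** N + 1 steps of length d = h / (N + 1), each with an error of order d^2, accumulate an error of
    order 1 / (N + 1). *)
Lemma euler_polygon r : good r -> exists C h0, [/\ 0 <= C, 0 < h0 &
  forall h (N : nat), 0 < h <= h0 -> exists y, [/\ close r y, y i0 = t i0 + h &
    forall j, `|c j y - c j t| <= C / N.+1%:R]].
Proof.
move=> gr; have [W W1 hW] := field_bounded gr.
have [/andP[r0 r1] h1 h2 _] := gr.
pose C j := s2val (cid2 (step_error j gr)).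
have C0 j : 0 <= C j by rewrite /C; case: cid2.
have hC j y d : close r y -> close r (step d y) -> `|d| <= 1 ->
    `|c j (step d y) - c j y| <= C j * d ^+ 2.
  by rewrite /C; case: cid2 => C' /= _; apply.
pose D := \sum_j C j; have D0 : 0 <= D by rewrite sumr_ge0.
have hD j : C j <= D by rewrite /D (bigD1 j) //= lerDl sumr_ge0.
have W0 : 0 < W by rewrite (lt_le_trans ltr01).
(* [D] dominates the error constants of all ratios, and [r / W] keeps the polygon, of speed at most
   [W], within distance [r]. *)
exists D, (r / W); split; [by []|by rewrite divr_gt0|move=> h N /andP[h0 hr]].
pose d := h / N.+1%:R.
have d0 : 0 < d by rewrite divr_gt0.
have hW' : h * W <= r by rewrite -ler_pdivlMr.
have h11 : h <= 1 by rewrite (le_trans hr) // ler_pdivrMr // mul1r (le_trans r1).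
have dh : N.+1%:R * d = h by rewrite mulrC divfK.
have d1 : d <= 1 by rewrite ler_pdivrMr // mul1r (le_trans h11) // ler1n.
pose y k := iter k (step d) t.
have ind k : (k <= N.+1)%N -> [/\ forall i, `|y k i - t i| <= k%:R * d * W,
    y k i0 = t i0 + k%:R * d & forall j, `|c j (y k) - c j t| <= k%:R * (D * d ^+ 2)].
  elim: k => [_|k IH kN].
    by split=> [i||j]; rewrite /y /= ?subrr ?normr0 ?mul0r ?addr0.
  have [i1 i2 i3] := IH (ltnW kN).
  have cl l : (l <= N.+1)%N -> l%:R * d * W <= r.
    move=> lN; apply: le_trans hW'; rewrite ler_pM2r // -dh ler_pM2r //.
    by rewrite ler_nat.
  have yk : close r (y k) by move=> i; rewrite (le_trans (i1 i)) // cl // ltnW.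
  have i1' i : `|y k.+1 i - t i| <= k.+1%:R * d * W.
    rewrite /y /= -/(y k) /step addrAC (le_trans (ler_normD _ _)) //.
    rewrite -addn1 natrD mulrDl mulrDl mul1r lerD // normrM (gtr0_norm d0).
    by rewrite ler_pM2l // hW.
  have yk1 : close r (step d (y k)).
    by move=> i; rewrite (le_trans (i1' i)) // cl.
  split=> // [|j].
    rewrite /y /= -/(y k) /step i2 /w mulfV ?mulr1.
      by rewrite -addrA -addn1 natrD mulrDl mul1r.
    by rewrite -normr_gt0 (lt_le_trans _ (h1 _ yk)) // divr_gt0 ?normr_gt0.
  rewrite /y /= -/(y k).
  have -> : c j (step d (y k)) - c j t =
    (c j (step d (y k)) - c j (y k)) + (c j (y k) - c j t) by ring.
  rewrite (le_trans (ler_normD _ _)) // -[k.+1]add1n natrD mulrDl mul1r lerD //.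
  by rewrite (le_trans (hC _ _ _ yk yk1 _)) ?gtr0_norm // ler_wpM2r // sqr_ge0.
have [j1 j2 j3] := ind N.+1 (leqnn _).
exists (y N.+1); split=> [i||j].
- by rewrite (le_trans (j1 i)) // dh.
- by rewrite j2 dh.
rewrite (le_trans (j3 j)) //.
have -> : N.+1%:R * (D * d ^+ 2) = D * (h * d) by rewrite -dh; ring.
rewrite ler_wpM2l // /d mulrA ler_piMl ?invr_ge0 //.
by rewrite mulr_ile1 // ltW.
Qed.

(** No solution of the differential equation is constructed: the polynomial [P] attains its minimum
    on a compact box, and the polygons push this minimum below every positive bound. *)
Lemma euler_fiber : exists2 h0, 0 < h0 & forall h, 0 < h <= h0 ->
  exists u, [/\ forall i, 0 < u i, u i0 = t i0 + h &
    exists2 k, k != 0 & forall j, (f j).@[u] = k * (f j).@[t]].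
Proof.
have [r gr] := good_radius.
have [C [h0 [C0 h00 hC]]] := euler_polygon gr.
have [/andP[r0 r1] h1 h2 h3] := gr.
exists h0 => // h hh.
(* P vanishes exactly where the ratios f_j / f_j0 are those of t. *)
pose P := \sum_j (f j * (f j0).@[t]%:MP - (f j).@[t]%:MP * f j0) ^+ 2.
(* The degenerate interval at [i0] prescribes the displacement [h] of that coordinate. *)
pose A i : set R := if i == i0 then `[t i0 + h, t i0 + h]%classic
                    else `[t i - r, t i + r]%classic.
pose K := [set x : 'rV[R]_n | forall i, A i (x ord0 i)].
have cK : compact K.
  by apply: rV_compact => i; rewrite /A; case: ifP => _; apply: segment_compact.
have inK y : close r y -> y i0 = t i0 + h -> K (\row_i y i).
  move=> yr yi i; rewrite mxE /A; case: eqP => [->|_] /=; rewrite in_itv /=.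
    by rewrite yi lexx.
  by have := yr i; rewrite ler_norml; lra.
have rowE (y : 'I_n -> R) : (fun i => (\row_k y k) ord0 i) =1 y.
  by move=> i; rewrite mxE.
have [x xK xmin] : exists2 x, x \in K & forall z, z \in K ->
    P.@[fun i => x ord0 i] <= P.@[fun i => z ord0 i].
  apply: EVT_min_rV => //.
    (* The polygon with a single step shows that the box is nonempty. *)
    have [y [yr yi _]] := hC h 0%N hh; by exists (\row_i y i); apply: inK.
  exact/continuous_subspaceT/meval_continuous.
pose u i := x ord0 i.
have Pe (z : 'I_n -> R) : P.@[z] =
    \sum_j ((f j).@[z] * (f j0).@[t] - (f j).@[t] * (f j0).@[z]) ^+ 2.
  rewrite /P rmorph_sum /=; apply: eq_bigr => j _.
  by rewrite rmorphXn /= mevalB !mevalM !mevalC.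
have [B B0 hB] := meval_bounded (f j0) (1 + \sum_k `|t k|).
pose M := B * `|(f j0).@[t]| * C.
have M0 : 0 <= M by rewrite !mulr_ge0.
have Ple N : P.@[u] <= \sum_(j : J) (M / N.+1%:R) ^+ 2.
  have [y [yr yi yc]] := hC h N hh.
  have := xmin (\row_i y i); rewrite inE => /(_ (inK y yr yi)).
  rewrite (meval_eq _ (rowE y)) => /le_trans; apply; rewrite Pe.
  apply: ler_sum => j _; rewrite -real_normK ?num_real //.
  rewrite lerXn2r ?nnegrE ?divr_ge0 //.
  have y0 : (f j0).@[y] != 0.
    by rewrite -normr_gt0 (lt_le_trans _ (h2 _ yr)) // divr_gt0 ?normr_gt0.
  have -> : (f j).@[y] * (f j0).@[t] - (f j).@[t] * (f j0).@[y] =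
      (f j0).@[y] * (f j0).@[t] * (c j y - c j t).
    by rewrite /c; field; rewrite y0 Hf0.
  rewrite !normrM /M -[leRHS]mulrA ler_pM ?mulr_ge0 //.
  by rewrite ler_wpM2r // (hB _ (close_bounded r1 yr)).
have P0 : P.@[u] = 0.
  apply/eqP; rewrite eq_le Pe sumr_ge0 ?andbT => [|j _]; last exact: sqr_ge0.
  rewrite -Pe leNgt; apply/negP => Pu0.
  (* For N + 1 above [X] the bound in [Ple] drops below the supposed positive minimum. *)
  pose X := #|J|%:R * M ^+ 2 / P.@[u].
  have X0 : 0 <= X by rewrite divr_ge0 ?mulr_ge0 ?sqr_ge0 // ltW.
  have [N XN] : exists N : nat, X < N.+1%:R.
    by exists (Num.truncn X); have /andP[_] := truncn_itv X0.
  have sE : \sum_(j : J) (M / N.+1%:R) ^+ 2 = #|J|%:R * M ^+ 2 / N.+1%:R ^+ 2.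
    by rewrite sumr_const -[LHS]mulr_natl expr_div_n mulrA.
  have := Ple N; rewrite sE.
  rewrite ler_pdivlMr ?exprn_gt0 // leNgt => /negP; apply.
  move: XN; rewrite /X ltr_pdivrMr // => /lt_le_trans; apply.
  by rewrite mulrC ler_pM2l // ler_eXnr // ler1n.
have eqs j : (f j).@[u] * (f j0).@[t] = (f j).@[t] * (f j0).@[u].
  have /eqP := P0; rewrite Pe psumr_eq0 => [/allP/(_ j)|i _]; last exact: sqr_ge0.
  by rewrite mem_index_enum => /(_ isT) /=; rewrite sqrf_eq0 subr_eq0 => /eqP.
have ucl : close r u.
  move=> i; move: xK; rewrite inE => /(_ i); rewrite -/(u i) /A.
  case: eqP => [->|_] /=; rewrite in_itv /= ler_norml; last by lra.
  have [y [yr yi _]] := hC h 0%N hh.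
  by have := yr i0; rewrite yi ler_norml; lra.
exists u; split; first exact: h3.
  move: xK; rewrite inE => /(_ i0); rewrite -/(u i0) /A eqxx /= in_itv /=.
  by move=> /le_anti.
exists ((f j0).@[u] / (f j0).@[t]).
  rewrite mulf_neq0 ?invr_eq0 // -normr_gt0 (lt_le_trans _ (h2 _ ucl)) //.
  by rewrite divr_gt0 ?normr_gt0.
by move=> j; apply: (mulIf Hf0); rewrite eqs mulrAC divfK // mulrC.
Qed.

End Euler.

(** * Existence of the scaling field *)

Lemma fraction_repr (A : idomainType) (x : {fraction A}) :
  exists p q : A, q != 0 /\ x * tofrac q = tofrac p.
Proof.
elim/quotP: x => x _; exists (fraction.frac x).1, (fraction.frac x).2.
split; first exact: denom_ratioP.
unlock FracField.tofrac; rewrite -[LHS]FracField.pi_mul; apply/eqmodP => /=.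
rewrite FracField.equivfE /FracField.mulf.
rewrite !numden_Ratio ?oner_eq0 ?mulf_neq0 ?denom_ratioP //.
all: by rewrite ?mulr1 ?oner_neq0 // mulrC.
Qed.

Lemma common_denominator (A : idomainType) (I : finType) (x : I -> {fraction A}) :
  exists (b : A) (a : I -> A), b != 0 /\ forall i, x i * tofrac b = tofrac (a i).
Proof.
have /choice[p hp] := fun i => fraction_repr (x i).
have /choice[q hq] := hp.
exists (\prod_i q i), (fun i => p i * \prod_(j | j != i) q j); split.
  by apply/prodf_neq0 => i _; have [] := hq i.
by move=> i; rewrite (bigD1 i) //= !tofracM mulrA; have [_ ->] := hq i.
Qed.

(* n + 1 unknowns v_1, ..., v_n, lam and e <= n linear equations. *)
Lemma exists_scaling_field (R : realType) n e (f : 'I_e -> {mpoly R[n]}) j0 :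
  (e <= n)%N -> f j0 != 0 ->
  exists (v : 'I_n -> {mpoly R[n]}) (lam : {mpoly R[n]}),
    (forall j, \sum_i v i * (f j)^`M(i) = lam * f j) /\ exists i, v i != 0.
Proof.
move=> en f0.
(* The rows are indexed by the unknowns, lam last; with only e <= n columns the left kernel is
   nonzero. *)
pose A : 'M[ratfun R n]_(n + 1, e) :=
  col_mx (\matrix_(i, j) tofrac (f j)^`M(i)) (\row_j - tofrac (f j)).
have /rowV0Pn[u /sub_kermxP uA u0] : kermx A != 0.
  rewrite kermx_eq0 /row_free neq_ltn; apply/orP; left.
  by rewrite (leq_ltn_trans (rank_leq_col A)) // addn1 ltnS.
have [b [a [b0 ha]]] := common_denominator (fun i => u ord0 i).
have bK : tofrac b != 0 by rewrite tofrac_eq0.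
exists (fun i => a (lshift 1 i)), (a (rshift n ord0)).
have eq j : \sum_i a (lshift 1 i) * (f j)^`M(i) = a (rshift n ord0) * f j.
  apply: (@tofrac_inj {mpoly R[n]}); rewrite rmorph_sum tofracM /= -ha.
  have := congr1 (fun M : 'rV_e => M ord0 j * tofrac b) uA.
  rewrite !mxE mul0r big_split_ord /= big_ord1 col_mxEd mxE.
  under eq_bigr do rewrite col_mxEu mxE.
  rewrite mulrN mulrBl mulrAC => /eqP; rewrite subr_eq0 => /eqP <-.
  rewrite mulr_suml; apply: eq_bigr => i _.
  by rewrite tofracM -ha mulrAC.
(* If every v_i vanished, lam f_j0 = 0 would give lam = 0, and the kernel vector would be zero. *)
split=> //; apply: contrapT => /forallNP v0.
have {}v0 i : a (lshift 1 i) = 0 by apply/eqP; have /negP := v0 i; rewrite negbK.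
have l0 : a (rshift n ord0) = 0.
  have /esym/eqP := eq j0; rewrite big1 => [|i _]; last by rewrite v0 mul0r.
  by rewrite mulf_eq0 (negPf f0) orbF => /eqP.
case/eqP: u0; apply/rowP => i; rewrite mxE; apply: (mulIf bK).
rewrite ha mul0r; case: (splitP i) => k ik.
  by rewrite (_ : i = lshift 1 k) ?v0 ?tofrac0 //; apply: val_inj.
rewrite (_ : i = rshift n ord0) ?l0 ?tofrac0 //; apply: val_inj => /=.
by rewrite ik ord1.
Qed.

(** Without tightness all a + b = 2 n + 2 + e - z coefficients of the core, the leading ones
    included, are at most as many as the parameters. So a scaling field exists for them, and [q] is
    one of its nonzero components. *)
Lemma infinite_core_fiber (R : realType) N : ~~ tight N ->
  exists2 q : {mpoly R[nparams N]}, q != 0 &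
    forall t, (forall i, 0 < t i) -> q.@[t] != 0 -> infinite_set (core_fiber t).
Proof.
move=> nt.
pose C := core (@variables R (nparams N)).
have [i|_ _ _ _ [s2 s1]] := @core_rmorph_pos _ _ (meval (fun=> 1)) N (@variables R _).
  by rewrite /= mevalXU ltr01.
pose a := size C.1; pose b := size C.2.
have b0 : (0 < b)%N by rewrite /b s2.
have ab : (a + b <= nparams N)%N.
  have := nparams_gap N; move: nt; rewrite /tight.
  by move: s1 s2; rewrite -/a -/b => s1 s2; lia.
pose f (j : 'I_(a + b)) :=
  match fintype.split j with inl k => C.1`_k | inr k => C.2`_k end.
have fl k : f (lshift b k) = C.1`_k by rewrite /f (unsplitK (inl _ k)).
have fr k : f (rshift a k) = C.2`_k by rewrite /f (unsplitK (inr _ k)).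
pose j0 := rshift a (Ordinal b0).
have coreE (t : 'I_(nparams N) -> R) :
    core t = (map_poly (meval t) C.1, map_poly (meval t) C.2).
  by rewrite -core_map meval_variables.
have f0 (t : 'I_(nparams N) -> R) : (forall i, 0 < t i) -> 0 < (f j0).@[t].
  move=> /core_pos[_ + _ _ _]; rewrite coreE /= coef_map => h.
  by rewrite /j0 fr.
have fn0 : f j0 != 0.
  have : 0 < (f j0).@[fun=> 1] by apply: f0.
  by apply: contraTneq => ->; rewrite meval0 ltxx.
have [v [lam [Hv [i0 vi0]]]] := exists_scaling_field ab fn0.
exists (v i0) => // t t0 vt.
have ft0 : (f j0).@[t] != 0 by rewrite gt_eqF // f0.
have [h0 h00 hE] := euler_fiber Hv ft0 vt t0.
move=> fin.
(* Infinitely many values of the coordinate [i0], each taken on the fiber. *)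
pose g (k : nat) := t i0 + h0 / k.+1%:R.
have gI : injective g.
  move=> k l /addrI /(mulfI (lt0r_neq0 h00)) /invr_inj /eqP.
  by rewrite eqr_nat => /eqP[].
apply: infinite_nat.
have := finite_preimage (in2W gI) (finite_image (fun u => u i0) fin).
apply: sub_finite_set => k _ /=.
have [|u [u0 ui [c c0 uc]]] := hE (h0 / k.+1%:R).
  by rewrite divr_gt0 //= ler_pdivrMr // ler_peMr ?ler1n // ltW.
exists u => //; split=> //; exists c => //; rewrite !coreE /=.
congr (_, _); apply/polyP => l; rewrite coefZ !coef_map /=.
  case: (ltnP l a) => la; last by rewrite nth_default // !meval0 mulr0.
  by have := uc (lshift b (Ordinal la)); rewrite fl.
case: (ltnP l b) => lb; last by rewrite nth_default // !meval0 mulr0.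
by have := uc (rshift a (Ordinal lb)); rewrite fr.
Qed.

(** * Zero sets of polynomials and Lebesgue measure *)

Definition mtail n (m : 'X_{1..n.+1}) : 'X_{1..n} := [multinom m (lift ord0 i) | i < n].

Lemma mtail_inj n (m m' : 'X_{1..n.+1}) :
  m ord0 = m' ord0 -> mtail m = mtail m' -> m = m'.
Proof.
move=> h0 /mnmP ht; apply/mnmP => i; case: (unliftP ord0 i) => [j ->|-> //].
by have := ht j; rewrite !mnmE.
Qed.

Definition slice (R : comNzRingType) n (p : {mpoly R[n.+1]}) (x : R) : {mpoly R[n]} :=
  p \mPo [tuple of x%:MP :: [tuple 'X_i | i < n]].

Lemma meval_slice (R : comNzRingType) n (p : {mpoly R[n.+1]}) x (t : n.-tuple R) :
  (slice p x).@[tnth t] = p.@[tnth (cons_tuple x t)].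
Proof.
rewrite comp_mpoly_meval; apply: meval_eq => i.
case: (unliftP ord0 i) => [j ->|->]; last by rewrite !tnth0 mevalC.
by rewrite !tnthS tnth_mktuple mevalXU.
Qed.

Lemma sliceX (R : comNzRingType) n (m : 'X_{1..n.+1}) (x : R) :
  slice 'X_[m] x = x ^+ m ord0 *: 'X_[mtail m].
Proof.
rewrite /slice comp_mpolyX big_ord_recl tnth0 -rmorphXn mul_mpolyC; congr (_ *: _).
rewrite mpolyXE_id; apply: eq_bigr => i _.
by rewrite tnthS tnth_mktuple mnmE.
Qed.

(** The monomials of [p] sharing the tail of one monomial [m0] assemble to a coefficient of the
    slice, which is a nonzero univariate polynomial in [x]. *)
Lemma finite_slice_eq0 (R : idomainType) n (p : {mpoly R[n.+1]}) :
  p != 0 -> finite_set [set x | slice p x = 0].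
Proof.
move=> p0; have [m0 m0p] : exists m, m \in msupp p.
  by exists (mlead p); apply: mlead_supp.
pose r : {poly R} := \sum_(m <- msupp p | mtail m == mtail m0) p@_m *: 'X^(m ord0).
have rE x : (slice p x)@_(mtail m0) = r.[x].
  rewrite /slice comp_mpolyEX raddf_sum /= /r horner_sum.
  rewrite [RHS]big_mkcond /=; apply: eq_bigr => m _.
  rewrite -/(slice 'X_[m] x) sliceX !mcoeffZ mcoeffX.
  by case: eqP => _; rewrite ?mulr0 // hornerZ hornerXn mulr1.
have r0 : r != 0.
  apply/eqP => /polyP/(_ (m0 ord0)); rewrite coef0 /r coef_sum.
  rewrite big_mkcond (bigD1_seq m0) ?msupp_uniq //= !eqxx coefZ coefXn eqxx mulr1.
  rewrite big1 ?addr0 => [|m mm]; first by apply/eqP; rewrite -mcoeff_msupp.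
  case: eqP => // tm; rewrite coefZ coefXn; case: eqP => [h|_]; last exact: mulr0.
  by case/eqP: mm; apply: mtail_inj.
have [s hs] : exists s : seq R, forall x, root r x -> x \in s.
  have : forall k (q : {poly R}), (size q <= k)%N -> q != 0 ->
      exists s : seq R, forall x, root q x -> x \in s.
    elim=> [q|k IH q sq q0]; first by rewrite leqn0 size_poly_eq0 => ->.
    have [[a /factor_theorem[q' qE]]|nr] := pselect (exists a, root q a); last first.
      by exists [::] => x rx; case: nr; exists x.
    have q'0 : q' != 0 by apply: contra_neq q0 => q'0; rewrite qE q'0 mul0r.
    have [|//|s hs] := IH q'.
      by move: sq; rewrite qE size_mul ?polyXsubC_eq0 // size_XsubC addn2.
    exists (a :: s) => x; rewrite qE rootM root_XsubC inE => /orP[/hs ->|->//].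
    by rewrite orbT.
  by move/(_ (size r) r (leqnn _) r0).
apply: (@sub_finite_set _ _ [set` s]); last exact: finite_seq.
by move=> x /= sx; apply: hs; rewrite rootE -rE sx mcoeff0.
Qed.

Lemma finite_lebesgue_measurable (R : realType) (F : set R) :
  finite_set F -> measurable F.
Proof.
by move=> fF; apply: countable_measurable => //; apply: finite_set_countable.
Qed.

(** Every preimage under [f] is finite or cofinite, so [f] is measurable, and it vanishes almost
    everywhere. *)
Lemma integral_finite_support (R : realType) (f : R -> \bar R) (F : set R) :
  finite_set F -> (forall x, ~ F x -> f x = 0%E) ->
  (\int[@lebesgue_measure R]_x f x = 0)%E.
Proof.
move=> fF f0.
have mfin (Z : set \bar R) : ~ Z 0%E -> measurable (f @^-1` Z).
  move=> Z0; apply: finite_lebesgue_measurable; apply: sub_finite_set fF => x /= Zx.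
  by apply: contrapT => /f0 fx0; apply: Z0; rewrite -fx0.
have mf : measurable_fun setT f.
  move=> _ Y mY; rewrite setTI; have [Y0|] := pselect (Y 0%E); last exact: mfin.
  rewrite -[Y]setCK preimage_setC.
  by apply: (@measurableC _ (measurableTypeR R)); exact: (mfin (~` Y) (fun n => n Y0)).
rewrite (@ae_eq_integral _ _ _ _ setT (cst 0%E)) ?integral0 //.
exists F; split; first exact: finite_lebesgue_measurable.
  by apply: countable_lebesgue_measure0; apply: finite_set_countable.
move=> x /= nx; apply: contrapT => /f0 fx; apply: nx => _; exact: fx.
Qed.

Lemma lebesgue_tuple_ge0 (R : realType) n (A : set (n.-tuple R)) :
  (0 <= lebesgue_tuple A)%E.
Proof.
elim: n A => [A|n IH A] /=; first exact: measure_ge0.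
by apply: integral_ge0 => x _; apply: IH.
Qed.

Lemma mpoly0_meval_neq0 (R : comNzRingType) (p : {mpoly R[0]}) (v : 'I_0 -> R) :
  p != 0 -> p.@[v] != 0.
Proof.
rewrite [p]nvar0_mpolyC mevalC; apply: contra_neq => ->; exact: mpolyC0.
Qed.

(** All but finitely many slices are again nonzero polynomials, so the iterated integral vanishes by
    induction. *)
Lemma lebesgue_tuple_zeros (R : realType) n (p : {mpoly R[n]}) :
  p != 0 -> lebesgue_tuple [set t : n.-tuple R | p.@[tnth t] = 0] = 0%E.
Proof.
elim: n p => [p p0|n IH p p0] /=.
  rewrite diracE memNset //= => /eqP; apply/negP; exact: mpoly0_meval_neq0.
apply: (integral_finite_support (finite_slice_eq0 p0)) => x /= sx.
under eq_set do rewrite -meval_slice.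
by apply: IH; apply/eqP.
Qed.

Lemma measurable_meval (R : realType) n (p : {mpoly R[n]}) :
  measurable_fun [set: n.-tuple R] (fun t => p.@[tnth t]).
Proof.
elim/mpoly_ring_ind: p => [c|i|p q IHp IHq|p q IHp IHq].
- by under eq_fun do rewrite mevalC; exact: measurable_cst.
- by under eq_fun do rewrite mevalXU; apply: measurable_tnth.
- by under eq_fun do rewrite mevalD; apply: measurable_funD.
- by under eq_fun do rewrite mevalM; apply: measurable_funM.
Qed.

(* [B] need not be measurable: the simple function used as a minorant of the
   integrand is. *)
Lemma lebesgue_tuple_nonzeros (R : realType) n (p : {mpoly R[n]}) (B : set (n.-tuple R)) :
  p != 0 -> (forall t, @param_space R n t -> p.@[tnth t] != 0 -> B t) ->
  (1 <= lebesgue_tuple B)%E.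
Proof.
elim: n p B => [p B p0 hB|n IH p B p0 hB] /=.
  rewrite diracE mem_set //; apply: hB; first by case.
  exact: mpoly0_meval_neq0.
set F := [set x | slice p x = 0]; have fF : finite_set F by exact: finite_slice_eq0.
have mF := finite_lebesgue_measurable fF.
(* First coordinates in the open unit interval are positive and still have measure 1 after the
   finite set [F] is removed. *)
pose S : set R := `]0, 1[%classic `\` F.
have mS : measurable S by apply: measurableD.
have S1 : (1 <= @lebesgue_measure R S)%E.
  have <- : @lebesgue_measure R `]0, 1[%classic = 1%E.
    by rewrite lebesgue_measure_itv /= lte_fin ltr01 sube0.
  have F0 : @lebesgue_measure R F = 0%E.
    by apply: countable_lebesgue_measure0; apply: finite_set_countable.
  rewrite -(@measureU0 _ (measurableTypeR R) R (@lebesgue_measure R) S F mS mF F0).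
  apply: le_measure; rewrite ?inE //.
    by apply: measurableU.
  by move=> x x01; have [Fx|nFx] := pselect (F x); [right|left].
apply: (le_trans S1); rewrite ge0_integralTE; last by move=> x; apply: lebesgue_tuple_ge0.
rewrite -sintegral_indic //.
apply: ereal_sup_ubound; exists (@indic_nnsfun _ (measurableTypeR R) R S mS) => //= x.
rewrite mindicE; case: (boolP (x \in S)) => [|_]; last exact: lebesgue_tuple_ge0.
rewrite inE => -[/=]; rewrite in_itv /= => /andP[x0 _] /= nF.
apply: (IH (slice p x)); first exact/eqP.
move=> t t0; rewrite meval_slice => pt; apply: hB => // i.
by case: (unliftP ord0 i) => [j ->|->]; rewrite ?tnthS ?tnth0.
Qed.

(** * Identifiability *)

(** [q] is the resultant of the generic core, nonzero because it does not vanish at the point of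
    [exists_coprime_core]. *)
Lemma generic_coprime_core (R : realType) N :
  exists2 q : {mpoly R[nparams N]}, q != 0 &
    forall t, (forall i, 0 < t i) -> q.@[t] != 0 -> coprimep (core t).1 (core t).2.
Proof.
pose C := core (@variables R (nparams N)).
have coreE (t : 'I_(nparams N) -> R) :
    core t = (map_poly (meval t) C.1, map_poly (meval t) C.2).
  by rewrite -core_map meval_variables.
have cE (t : 'I_(nparams N) -> R) : (forall i, 0 < t i) ->
    coprimep (core t).1 (core t).2 = ((resultant C.1 C.2).@[t] != 0).
  move=> t0; have [i|_ _ a b _] := @core_rmorph_pos _ _ (meval t) N (@variables R _).
    by rewrite /= mevalXU.
  by rewrite coreE coprimep_map_resultant // gt_eqF.
exists (resultant C.1 C.2) => [|t t0]; last by rewrite cE.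
have [v v0] := exists_coprime_core R N; rewrite cE //.
by apply: contra_neq => ->; rewrite meval0.
Qed.

Lemma core_fiberE (R : realType) s N (t : (nparams N).-tuple R) :
  param_space t -> core_fiber (tnth t) = (@tnth _ R) @` coef_fiber s t.
Proof.
move=> t0; apply/seteqP; split=> [u [u0 h]|_ [u [u0 /(coef_map_eqP _ u0 t0) h] <-]].
  have uE : tnth [tuple u i | i < nparams N] = u.
    by apply/funext => i; rewrite tnth_mktuple.
  have p0 : param_space [tuple u i | i < nparams N] by move=> i; rewrite tnth_mktuple.
  exists [tuple u i | i < nparams N] => //; split=> //.
  by apply/(coef_map_eqP _ p0 t0); rewrite uE.
by split.
Qed.

Lemma finite_coef_fiber (R : realType) s N (t : (nparams N).-tuple R) :
  param_space t -> finite_set (coef_fiber s t) <-> finite_set (core_fiber (tnth t)).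
Proof.
move=> t0; rewrite (core_fiberE s t0); split; first exact: finite_image.
move/(finite_preimage (f := @tnth _ R)) => h.
apply: sub_finite_set (h _); first by move=> u hu; exists u.
by move=> u v _ _ /funeqP e; apply: eq_from_tnth => i; rewrite e.
Qed.

Lemma ae_generic (R : realType) n (q : {mpoly R[n]}) (P : n.-tuple R -> Prop) :
  q != 0 -> (forall t, q.@[tnth t] != 0 -> P t) ->
  {ae @lebesgue_tuple R n, forall t, P t}.
Proof.
move=> q0 h; exists [set t | q.@[tnth t] = 0]; split.
- have := @measurable_meval R n q measurableT [set 0] (measurable_set1 _).
  by rewrite setTI.
- exact: lebesgue_tuple_zeros.
- by move=> t /= nP; apply/eqP; apply: contra_notT nP; apply: h.
Qed.

Lemma tight_identifiable (R : realType) s N : tight N -> locally_identifiable R s N.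
Proof.
move=> tN; have [q q0 hq] := generic_coprime_core R N.
apply: (ae_generic q0) => t qt t0; apply/(finite_coef_fiber _ t0).
by apply: finite_core_fiber => //; apply: hq.
Qed.

Lemma loose_unidentifiable (R : realType) s N : ~~ tight N -> unidentifiable R s N.
Proof.
move=> tN; have [q q0 hq] := infinite_core_fiber R tN.
apply: (ae_generic q0) => t qt t0 /(finite_coef_fiber _ t0).
exact: hq.
Qed.

(** If tightness failed, the null set outside which the fibers are finite would contain all positive
    points off the zeros of [q], against the lower bound 1 for the measure of such a set. *)
Lemma identifiable_tight (R : realType) s N : locally_identifiable R s N -> tight N.
Proof.
move=> [B [mB B0 hB]]; apply: contraT => tN.
have [q q0 hq] := infinite_core_fiber R tN.
have : (1 <= lebesgue_tuple B)%E.
  apply: (lebesgue_tuple_nonzeros q0) => t t0 qt; apply: hB => /= h.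
  by apply: (hq _ t0 qt); apply/(finite_coef_fiber s t0)/h.
by rewrite B0 lee_fin ler10.
Qed.

(** The condition is that of [tight_par], so the entries u are those at which tightness is lost. *)
Lemma par_table_type N1 N2 : par_table (type_of N1) (type_of N2) =
  if ~~ (excess N1 && excess N2) && (no_const N1 || no_const N2)
  then Some (type_of (Par N1 N2)) else None.
Proof.
rewrite /type_of /=; case: (no_const N1); case: (no_const N2);
  by case: (excess N1); case: (excess N2).
Qed.

Lemma ser_table_type N1 N2 : ser_table (type_of N1) (type_of N2) =
  if (excess N1 || excess N2) && ~~ (no_const N1 && no_const N2)
  then Some (type_of (Ser N1 N2)) else None.
Proof.
rewrite /type_of /=; case: (no_const N1); case: (no_const N2);
  by case: (excess N1); case: (excess N2).
Qed.

Theorem theorem5 (R : realType) (N1 N2 : network) (T1 T2 : ntype)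
    (s1 s2 s : side)
    (id1 : locally_identifiable R s1 N1) (id2 : locally_identifiable R s2 N2)
    (ty1 : has_type R N1 T1) (ty2 : has_type R N2 T2) :
  [/\ joined_as R s (Par N1 N2) (par_table T1 T2),
      joined_as R s (Ser N1 N2) (ser_table T1 T2),
      commutative par_table & commutative ser_table].
Proof.
move/has_typeP: ty1 => ->; move/has_typeP: ty2 => ->.
(* Tightness does not mention the side of normalization, so [s1], [s2] and [s] may differ. *)
have t1 := identifiable_tight id1; have t2 := identifiable_tight id2.
split; [rewrite par_table_type|rewrite ser_table_type|by case=> [] []|by case=> [] []].
  have := tight_par N1 N2; rewrite t1 t2 /= => tP.
  case: ifP => h; rewrite h in tP; last by apply: loose_unidentifiable; rewrite tP.
  by split; [exact: tight_identifiable|exact/has_typeP].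
have := tight_ser N1 N2; rewrite t1 t2 /= => tS.
case: ifP => h; rewrite h in tS; last by apply: loose_unidentifiable; rewrite tS.
by split; [exact: tight_identifiable|exact/has_typeP].
Qed.
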